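(* $\mathbf W_{\mathbf M}$ is a (possibly $\infty$-valued) metric on the space $\mathcal M(\mathbb R;S)$; that is, $\mathbf W_{\mathbf M}:\mathcal M(\mathbb R;S)\times\mathcal M(\mathbb R;S)\to[0,\infty]$ is symmetric, satisfies the triangle inequality, and $\mathbf W_{\mathbf M}(\mu_0,\mu_1)=0$ if and only if $\mu_0=\mu_1$.
   Context: Let $S\subset\mathbb R^n$ be convex and compact with nonempty interior $\mathrm{int}(S)$. $\mathcal M(\mathbb R;A)$ denotes the set of measurable functions $\mathbb R\to A$ (identified almost everywhere). The mobility matrix $\mathbf M:S\to\mathbb R^{n\times n}$ satisfies: (C0) $\mathbf M$ is continuous on $S$ and smooth on $\mathrm{int}(S)$; (C1) $\mathbf M(z)$ is symmetric positive definite for each $z\in\mathrm{int}(S)$; (C2) $\mathrm D^2\mathbf M(z)[\zeta,\zeta]$ is negative semidefinite for each $z\in\mathrm{int}(S)$, $\zeta\in\mathbb R^n$; (C3) $\mathbf M(z)\nu=0$ if $z\in\partial S$ and $\nu$ is a normal vector to $\partial S$ at $z$. Let $\tilde\phi(z,p)=p^{\mathrm T}\mathbf M(z)^{-1}p$ on $\mathrm{int}(S)\times\mathbb R^n$ and let $\phi:S\times\mathbb R^n\to[0,\infty]$ be its lower semicontinuous envelope, $\phi(\tilde z,\tilde p)=\liminf_{(z,p)\to(\tilde z,\tilde p)}\tilde\phi(z,p)$ (with $(z,p)\in\mathrm{int}(S)\times\mathbb R^n$). For $T>0$, $\mathscr C_T$ is the set of curves $(\mu,w)=(\mu_t,w_t)_{t\in[0,T]}$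 such that: $t\mapsto\mu_t\in\mathcal M(\mathbb R;S)$ is weakly$\ast$-continuous (i.e. $t\mapsto\int\mu_t^{\mathrm T}\rho\,dx$ is continuous for each $\rho\in C_c^0(\mathbb R;\mathbb R^n)$); $(w_t)$ is a Borel-measurable family in $\mathcal M(\mathbb R;\mathbb R^n)$; $\int_0^T\int_{-R}^R|w_t|\,dx\,dt<\infty$ for each $R>0$; and $\partial_t\mu+\partial_xw=0$ in the sense of distributions on $[0,T]\times\mathbb R$. $\mathscr C_T(\hat\mu\to\check\mu)$ is the subset with $\mu|_{t=0}=\hat\mu$, $\mu|_{t=T}=\check\mu$. Then $\mathbf W_{\mathbf M}(\mu_0,\mu_1)=\big[\inf\{\int_0^1\int_{\mathbb R}\phi(\mu_t(x),w_t(x))\,dx\,dt:(\mu,w)\in\mathscr C_1(\mu_0\to\mu_1)\}\big]^{1/2}\in[0,\infty]$ (with $\inf\emptyset=+\infty$). *)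

(* Defs.v *)
From HB Require Import structures.
From mathcomp Require Import all_boot all_order all_algebra.
From mathcomp Require Import all_classical all_reals all_analysis.

Set Implicit Arguments.
Unset Strict Implicit.
Unset Printing Implicit Defensive.

Import Order.TTheory GRing.Theory Num.Theory.
Import numFieldNormedType.Exports.

Local Open Scope classical_set_scope.
Local Open Scope ring_scope.

Definition dotcv (R : realType) (n : nat) (u v : 'cV[R]_n) : R :=
  (u^T *m v) 0 0.

Definition quadf (R : realType) (n : nat) (A : 'M[R]_n) (u : 'cV[R]_n) : R :=
  (u^T *m A *m u) 0 0.

(* [C_k k U f]: f is C^k on the open set U; all iterated directional
   derivatives up to order k exist and are continuous on U.  For
   finite-dimensional V this is the usual notion. *)
Fixpoint C_k (R : realType) (V W : normedModType R) (k : nat) (U : set V)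
    (f : V -> W) : Prop :=
  match k with
  | 0%N => forall x, U x -> {for x, continuous f}
  | k'.+1 => (forall x v, U x -> derivable f x v) /\
             (forall v, C_k k' U (fun x => 'D_v f x : W))
  end.

Definition smooth_on (R : realType) (V W : normedModType R) (U : set V)
  (f : V -> W) : Prop := forall k, C_k k U f.

(* D^2 M(z)[zeta, zeta] *)
Definition second_deriv (R : realType) (V W : normedModType R) (f : V -> W)
  (z zeta : V) : W := 'D_zeta (fun y => 'D_zeta f y : W) z.

Definition sym_posdef (R : realType) (n : nat) (A : 'M[R]_n) : Prop :=
  A^T = A /\ forall u, u != 0 -> 0 < quadf A u.

Definition neg_semidef (R : realType) (n : nat) (A : 'M[R]_n) : Prop :=
  A^T = A /\ forall u, quadf A u <= 0.

Definition bdry (T : topologicalType) (S : set T) : set T :=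
  closure S `\` interior S.

(* Normal vectors in the sense of convex analysis, as the boundary of a
   convex set need not be smooth. *)
Definition normal_vector (R : realType) (n : nat) (S : set 'cV[R]_n)
  (z nu : 'cV[R]_n) : Prop := forall y, S y -> dotcv nu (y - z) <= 0.

Section MeasurableFunctionSpace.
Variables (R : realType) (n : nat) (A : set 'cV[R]_n).

Record mfun_to := MfunTo {
  mfun_to_fun :> R -> 'cV[R]_n;
  mfun_to_measurable :
    forall i, measurable_fun [set: R] (fun x => mfun_to_fun x i 0);
  mfun_to_in : forall x, A (mfun_to_fun x) }.

HB.instance Definition _ := gen_eqMixin mfun_to.
HB.instance Definition _ := gen_choiceMixin mfun_to.

Definition mfun_to_ae (f g : mfun_to) : bool :=
  `[< {ae @lebesgue_measure R, forall x, f x = g x} >].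

Lemma mfun_to_ae_refl : reflexive mfun_to_ae.
Proof. by move=> f; apply/asboolP; exact: aeW. Qed.

Lemma mfun_to_ae_sym : symmetric mfun_to_ae.
Proof.
have H f g : mfun_to_ae f g -> mfun_to_ae g f.
  by move=> /asboolP h; apply/asboolP; apply: (@filterS _ _ (ae_filter_ringOfSetsType _)) h => x ->.
by move=> f g; apply/idP/idP; exact: H.
Qed.

Lemma mfun_to_ae_trans : transitive mfun_to_ae.
Proof.
move=> g f h /asboolP fg /asboolP gh; apply/asboolP.
by apply: (@filterS2 _ _ (ae_filter_ringOfSetsType _)) fg gh => x -> ->.
Qed.

Canonical mfun_to_ae_equiv :=
  EquivRel mfun_to_ae mfun_to_ae_refl mfun_to_ae_sym mfun_to_ae_trans.

Local Open Scope quotient_scope.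

(* The space M(R; A): measurable functions R -> A identified a.e. *)
Definition mspace : Type := {eq_quot mfun_to_ae}.
HB.instance Definition _ := Choice.on mspace.
HB.instance Definition _ := EqQuotient.on mspace.

(* Everything below depends on an element of [mspace] only through integrals,
   hence not on this choice of representative. *)
Definition mspace_fun (f : mspace) : R -> 'cV[R]_n := repr f.
Coercion mspace_fun : mspace >-> Funclass.

End MeasurableFunctionSpace.

Section TransportDistance.
Variables (R : realType) (n : nat).
Variables (S : set 'cV[R]_n) (M : 'cV[R]_n -> 'M[R]_n).

Local Notation leb := (@lebesgue_measure R).

Definition phi_tilde (z p : 'cV[R]_n) : R := quadf (invmx (M z)) p.

Definition phi (z p : 'cV[R]_n) : \bar R :=
  limf_einf (fun zp : 'cV[R]_n * 'cV[R]_n => (phi_tilde zp.1 zp.2)%:E)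
    (within (interior S `*` setT) (nbhs (z, p))).

(* rho \in C_c^0(R; R^n) *)
Definition Cc0 (rho : R -> 'cV[R]_n) : Prop :=
  continuous rho /\ compact (closure [set x | rho x != 0]).

(* psi \in C_c^oo((0,T) x R) *)
Definition test_function (T : R) (psi : R * R -> R) : Prop :=
  [/\ smooth_on setT psi,
      compact (closure [set z | psi z != 0]) &
      closure [set z | psi z != 0] `<=` `]0, T[ `*` setT].

Definition weakly_star_continuous (T : R) (mu : R -> mspace S) : Prop :=
  forall rho, Cc0 rho ->
    {within `[0, T], continuous
      (fun t => \int[leb]_x dotcv (mu t x) (rho x))}.

Definition measurable_family (T : R) (w : R -> R -> 'cV[R]_n) : Prop :=
  forall i, measurable_fun (`[0, T] `*` [set: R])
    (fun tx : R * R => w tx.1 tx.2 i 0).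

Definition locally_integrable_family (T : R) (w : R -> R -> 'cV[R]_n) : Prop :=
  forall r : R, 0 < r ->
    (\int[leb]_(t in `[0%R, T]) \int[leb]_(x in `[(- r)%R, r]) (`|w t x|)%:E
      < +oo)%E.

(* d_t mu + d_x w = 0 in the sense of distributions, componentwise *)
Definition continuity_equation (T : R) (mu : R -> mspace S)
    (w : R -> R -> 'cV[R]_n) : Prop :=
  forall (psi : R * R -> R) (i : 'I_n), test_function T psi ->
    \int[leb]_(t in `[0, T]) \int[leb]_x ('D_(1, 0) psi (t, x) * mu t x i 0) +
    \int[leb]_(t in `[0, T]) \int[leb]_x ('D_(0, 1) psi (t, x) * w t x i 0)
    = 0.

(* The set C_T(mu0 -> mu1).  Curves are total in time, but only their values
   on [0, T] are constrained or used. *)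
Definition curves (T : R) (mu0 mu1 : mspace S) :
    set ((R -> mspace S) * (R -> R -> 'cV[R]_n)) :=
  [set c | [/\ weakly_star_continuous T c.1,
               measurable_family T c.2,
               locally_integrable_family T c.2,
               continuity_equation T c.1 c.2 &
               c.1 0 = mu0 /\ c.1 T = mu1]].

Definition action (mu : R -> mspace S) (w : R -> R -> 'cV[R]_n) : \bar R :=
  (\int[leb]_(t in `[0%R, 1%R]) \int[leb]_x phi (mu t x) (w t x))%E.

Definition W (mu0 mu1 : mspace S) : \bar R :=
  sqrte (ereal_inf [set action c.1 c.2 | c in curves 1 mu0 mu1]).

End TransportDistance.

(* Main.v *)
Require Import Defs.
From HB Require Import structures.
From mathcomp Require Import all_boot all_order all_algebra.
From mathcomp Require Import all_classical all_reals all_analysis.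
From mathcomp Require Import measurable_realfun.
From mathcomp Require Import ring lra.

Set Implicit Arguments.
Unset Strict Implicit.
Unset Printing Implicit Defensive.

Import Order.TTheory GRing.Theory Num.Theory.
Import numFieldNormedType.Exports.

Local Open Scope classical_set_scope.
Local Open Scope ring_scope.

(** Every metric axiom comes from an operation on curves.

    Symmetry: running a curve backwards, with the flux negated, keeps the
    action, because the action density is 2-homogeneous and even in the flux.

    Triangle inequality: running one curve on [0, s] and another one on [s, 1]
    divides their actions by s and by 1 - s.  If the actions are below p ^ 2
    and q ^ 2, then s = p / (p + q) makes the total smaller than (p + q) ^ 2.

    Vanishing on the diagonal: the constant curve with zero flux has action 0,
    because the density vanishes at zero flux over the interior of S; this
    interior is dense in the convex set S, so the lower semicontinuous envelope
    vanishes at zero flux over all of S.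

    Definiteness: by the Cauchy-Schwarz inequality for the quadratic form of
    M z, the square of p_i is at most (M z)_ii times the density at interior
    points z, and M is bounded on the compact set S; so phi (z, p) is at least
    c * p_i ^ 2 for some c > 0.  The pairing of the two end points with a smooth
    compactly supported function rho of x differs by the space-time integral of
    rho' * w, which this bound controls by the action.  Curves of arbitrarily
    small action thus force the end points to have the same integral against
    every rho, and hence to agree almost everywhere.

    Two points need care.  First, the distributional equation only sees test
    functions that vanish near times 0 and 1, whereas definiteness and
    gluing concern the values at the end points.  The bridge is
    [boundary_identity]: for psi smooth and supported in a bounded range of x,
    but unrestricted at the end times, the equation holds with the boundary
    terms at t = 0 and t = 1.  It follows from the weak-star continuity of the
    curve by cutting off in time, the derivatives of the cut-offs
    concentrating at the end points.  With it, the glued curve solves the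
    equation because the boundary terms at the junction cancel.

    Second, the action is defined whether or not phi is measurable along the
    curve, so it is an iterated lower integral: for a nonnegative integrand, the
    supremum of the integrals of the simple functions below it.
    Monotonicity, positive homogeneity and affine changes of variable survive
    for lower integrals; subadditivity does not in general, but it does when
    one summand is measurable, and across a splitting of the domain into
    measurable pieces, which is all that the estimates use. *)

(** * Smooth functions *)
Section Smooth.
Context {R : realType}.
Implicit Types V U : normedModType R.

Lemma smooth_on_derive V (f : V -> R) v :
  smooth_on setT f -> smooth_on setT (fun x => 'D_v f x).
Proof. by move=> sf k; case: (sf k.+1) => _ /(_ v). Qed.

Lemma smooth_on_derivable V (f : V -> R) x v :
  smooth_on setT f -> derivable f x v.
Proof. by move=> sf; case: (sf 1%N) => /(_ x v I). Qed.

Lemma smooth_on_continuous V (f : V -> R) : smooth_on setT f -> continuous f.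
Proof. by move=> sf x; exact: (sf 0%N). Qed.

Lemma smooth_on_cst V (c : R) : smooth_on [set: V] (fun=> c).
Proof.
suff H k : forall c : R, C_k k [set: V] (fun=> c) by move=> k; exact: H.
elim: k => [|k IH] {}c /=; first by move=> x _; exact: cst_continuous.
split=> [x v _|v]; first exact: derivable_cst.
under eq_fun do rewrite derive_cst; exact: IH.
Qed.

Lemma C_kD V k (f g : V -> R) : C_k k setT f -> C_k k setT g ->
  C_k k setT (fun x => f x + g x).
Proof.
elim: k f g => [|k IH] f g /=.
  by move=> cf cg x _; apply: continuousD; [exact: cf|exact: cg].
move=> [df Cf] [dg Cg]; split=> [x v _|v].
  by apply: derivableD; [exact: df|exact: dg].
rewrite (_ : (fun x => _) = (fun x => 'D_v f x + 'D_v g x)).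
  exact: IH.
by apply/funext => x; rewrite -deriveD //; [exact: df|exact: dg].
Qed.

Lemma smooth_onD V (f g : V -> R) : smooth_on setT f -> smooth_on setT g ->
  smooth_on setT (fun x => f x + g x).
Proof. by move=> sf sg k; exact: C_kD. Qed.

Lemma smooth_on_deriveM V (f g : V -> R) x v :
  smooth_on setT f -> smooth_on setT g ->
  'D_v (fun x => f x * g x) x = f x * 'D_v g x + g x * 'D_v f x.
Proof.
by move=> sf sg; rewrite -deriveM//; exact: smooth_on_derivable.
Qed.

(** The Leibniz rule expresses the derivative of a product of smooth functions
    through products of smooth functions, so the induction on the order needs
    smoothness of both factors at all orders, not only at order [k]. *)
Lemma smooth_onM V (f g : V -> R) : smooth_on setT f -> smooth_on setT g ->
  smooth_on setT (fun x => f x * g x).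
Proof.
move=> sf sg k; elim: k f g sf sg => [|k IH] f g sf sg /=.
  by move=> x _; apply: continuousM; exact: smooth_on_continuous.
split=> [x v _|v]; first by apply: derivableM; exact: smooth_on_derivable.
under eq_fun do rewrite smooth_on_deriveM//.
by apply: C_kD; apply: IH => //; exact: smooth_on_derive.
Qed.

Lemma smooth_onZ V c (f : V -> R) : smooth_on setT f ->
  smooth_on setT (fun x => c * f x).
Proof. by apply: smooth_onM; exact: smooth_on_cst. Qed.

(** [L] is affine with linear part [l], in the form in which directional
    derivatives use it.  This one notion covers slices, projections and affine
    changes of time. *)
Definition affine_along V U (L : V -> U) (l : V -> U) :=
  forall x v (h : R), L (h *: v + x) = h *: l v + L x.

Lemma derivable_affine V U (f : U -> R) (L l : V -> U) x v :
  affine_along L l -> derivable f (L x) (l v) -> derivable (f \o L) x v.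
Proof.
rewrite /derivable => aL /=.
by under eq_fun do rewrite -aL.
Qed.

Lemma derive_affine V U (f : U -> R) (L l : V -> U) x v :
  affine_along L l -> 'D_v (f \o L) x = 'D_(l v) f (L x).
Proof.
by rewrite /derive => aL /=; under [in RHS]eq_fun do rewrite -aL.
Qed.

Lemma smooth_on_affine V U (f : U -> R) (L l : V -> U) :
  affine_along L l -> continuous L ->
  smooth_on setT f -> smooth_on setT (fun x => f (L x)).
Proof.
move=> aL cL sf k; elim: k f sf => [|k IH] f sf /=.
  by move=> x _; apply: continuous_comp; [exact: cL|exact: (smooth_on_continuous sf)].
split=> [x v _|v].
  by apply: (derivable_affine aL); exact: smooth_on_derivable.
rewrite (_ : (fun x => _) = (fun x => 'D_(l v) f (L x))).
  by apply: (IH (fun y => 'D_(l v) f y)); exact: smooth_on_derive.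
by apply/funext => x; rewrite -(derive_affine f x v aL).
Qed.

Lemma deriveR (f : R -> R) x v : derivable f x 1 -> 'D_v f x = v * 'D_1 f x.
Proof.
move=> /derivable1_diffP df; rewrite !deriveE//.
by rewrite -[v in LHS]mulr1 -[_ * _]/(v *: (1 : R)) linearZ.
Qed.

Lemma derivableR (f : R -> R) x v : derivable f x 1 -> derivable f x v.
Proof. by move=> /derivable1_diffP df; exact: diff_derivable. Qed.

Lemma derive_affineR (f : R -> R) (c b t : R) : smooth_on setT f ->
  'D_1 (fun s => f (c * s + b)) t = c * 'D_1 f (c * t + b).
Proof.
move=> sf; have aL : affine_along (fun s : R => c * s + b) ( *%R c : R -> R).
  by move=> x v h; rewrite -![_ *: _]/(_ * _); ring.
apply: etrans (derive_affine f t 1 aL) _.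
by rewrite mulr1 deriveR//; exact: smooth_on_derivable.
Qed.

Lemma continuous_affineR (c b : R) : continuous (fun s => c * s + b).
Proof.
move=> t; apply: (@continuousD _ _ _ (fun t => c * t) (cst b)); last exact: cst_continuous.
exact: mulrl_continuous.
Qed.

Lemma smooth_on_affineR (f : R -> R) (c b : R) : smooth_on setT f ->
  smooth_on setT (fun s => f (c * s + b)).
Proof.
apply: (@smooth_on_affine R R f (fun s : R => c * s + b) ( *%R c : R -> R)).
  by move=> x v h; rewrite -![_ *: _]/(_ * _); ring.
exact: continuous_affineR.
Qed.

Lemma C_kW (f : R -> R) k : C_k k.+1 setT f -> C_k k setT f.
Proof.
elim: k f => [|k IH] f.
  case=> df _ x _; apply: differentiable_continuous.
  by apply/derivable1_diffP; exact: df.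
by case=> df Cf; split => // v; apply: IH; exact: Cf.
Qed.

(** On the line [C_k] is decreasing in [k], since differentiable functions are
    continuous there; this permits the Leibniz induction at a fixed order, as
    composition requires. *)
Lemma C_kM (f g : R -> R) k : C_k k setT f -> C_k k setT g ->
  C_k k setT (fun x => f x * g x).
Proof.
elim: k f g => [|k IH] f g.
  by move=> cf cg x _; apply: continuousM; [exact: cf|exact: cg].
move=> Cf Cg; have Cf' := C_kW Cf; have Cg' := C_kW Cg.
case: Cf Cg => [df Cf] [dg Cg]; split=> [x v _|v].
  by apply: derivableM; [exact: df|exact: dg].
rewrite (_ : (fun x => _) = (fun x => f x * 'D_v g x + g x * 'D_v f x)).
  by apply: C_kD; apply: IH; [|exact: Cg| |exact: Cf].
by apply/funext => x; rewrite -deriveM //; [exact: df|exact: dg].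
Qed.

Lemma is_derive_smooth (f : R -> R) (x : R) : smooth_on setT f ->
  is_derive x 1 f ('D_1 f x).
Proof. by move=> sf; apply/derivableP; exact: smooth_on_derivable. Qed.

Lemma smooth_on_comp (g f : R -> R) : smooth_on setT g -> smooth_on setT f ->
  smooth_on setT (fun x => g (f x)).
Proof.
move=> sg sf k.
have H (h : R -> R) (x : R) : smooth_on setT h ->
    is_derive x 1 (h \o f) ('D_1 h (f x) * 'D_1 f x).
  by move=> sh; apply: is_derive1_comp; exact: is_derive_smooth.
elim: k g sg => [|k IH] g sg /=.
  move=> x _; apply: (@continuous_comp _ _ _ f g).
    exact: (smooth_on_continuous sf).
  exact: (smooth_on_continuous sg).
have dgf x : derivable (g \o f) x 1 by case: (H g x sg).
split=> [x v _|v]; first exact: derivableR.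
rewrite (_ : (fun x => _) = (fun x => v * ('D_1 g (f x) * 'D_1 f x))).
  apply: C_kM; first exact: smooth_on_cst.
  apply: C_kM; last exact: (smooth_on_derive _ sf).
  by apply: (IH (fun y => 'D_1 g y)); exact: smooth_on_derive.
by apply/funext => x; rewrite deriveR//; case: (H g x sg) => _ ->.
Qed.

End Smooth.

(** * A smooth step *)
Section FlatFunction.
Context {R : realType}.
Implicit Types (t : R) (n : nat).

(** The function [t ^- n * exp (- 1 / t)] extended by 0.  The family is closed
    under differentiation, up to linear combinations, which makes the smoothness
    of each member provable by one induction over all [n]. *)
Definition flat n t : R := if 0 < t then t^-1 ^+ n * expR (- t^-1) else 0.

Lemma flat_ge0 n t : 0 <= flat n t.
Proof.
rewrite /flat; case: ifP => // t0.
by rewrite mulr_ge0 ?expR_ge0// exprn_ge0// invr_ge0 ltW.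
Qed.

(** The exponential series dominates each power, whence [exp (- 1 / t)] absorbs
    [t ^- (n + 1)]. *)
Lemma flat_le n t : flat n t <= n.+1`!%:R * `|t|.
Proof.
rewrite /flat; case: ifPn => t0; last by rewrite mulr_ge0.
have ti0 : 0 < t^-1 by rewrite invr_gt0.
have h : t^-1 ^+ n.+1 <= n.+1`!%:R * expR t^-1.
  have := @expR_ge1Dxn _ t^-1 n (ltW ti0) => h.
  rewrite mulrC -ler_pdivrMr ?ltr0n ?fact_gt0//.
  by apply: le_trans h; rewrite lerDr.
rewrite expRN ler_pdivrMr ?expR_gt0// gtr0_norm//.
by rewrite mulrAC -ler_pdivrMr// -exprSr.
Qed.

Lemma flatS n t : 0 < t -> flat n t = t * flat n.+1 t.
Proof.
by move=> t0; rewrite /flat t0 exprS !mulrA divff ?mul1r// gt_eqF.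
Qed.

Lemma flat_le0 n t : t <= 0 -> flat n t = 0.
Proof. by rewrite /flat ltNge => ->. Qed.

(** At 0 the difference quotient of [flat n] at [t > 0] is [flat n.+1 t], which
    is at most a constant times [t] by [flat_le]. *)
Lemma is_derive_flat n t :
  is_derive t 1 (flat n) (flat n.+2 t - n%:R * flat n.+1 t).
Proof.
have [t0|t0|->] := ltgtP t 0.
- rewrite !flat_le0 ?ltW// mulr0 subr0.
  apply: (@near_eq_is_derive _ _ _ (cst 0)).
  by near=> s; rewrite flat_le0// ltW//; near: s; exact: lt_nbhsl.
- apply: (@near_eq_is_derive _ _ _
    ((fun s => s^-1) ^+ n * (expR \o - (fun s => s^-1)))).
    near=> s; rewrite /flat ifT; last by near: s; exact: lt_nbhsr.
    by rewrite !fctE/=.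
  rewrite /flat t0.
  have tn0 : t != 0 by rewrite gt_eqF.
  have d1 : is_derive t 1 (fun s => s^-1) (- t ^- 2).
    have := @is_deriveV _ id t 1 1 tn0 (is_derive_id _ _).
    by rewrite /= -[_ *: _]/(_ * _) mulr1.
  have d2 := is_derive1_comp (is_derive_expR _) (is_deriveN d1).
  apply: is_derive_eq (is_deriveM (is_deriveX n d1) d2) _.
  rewrite /= !fctE /= -![_ *: _]/(_ * _) opprK.
  case: n => [|n] /=; last rewrite !exprS; by field.
- rewrite !flat_le0// mulr0 subr0.
  suff cv : h^-1 *: ((flat n \o shift 0) (h *: 1) - flat n 0) @[h --> 0^'] --> (0:R).
    split; first by apply/cvg_ex; exists 0.
    exact/cvg_lim.
  apply/cvgr0Pnorm_le => e e0 /=.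
  have C0 : 0 < n.+2`!%:R :> R by rewrite ltr0n fact_gt0.
  near=> h.
  rewrite (@flat_le0 n 0)// subr0 addr0 -![_ *: _]/(_ * _) mulr1.
  have [h0|h0] := leP h 0; first by rewrite flat_le0// mulr0 normr0 ltW.
  rewrite flatS// mulKf ?gt_eqF// ger0_norm ?flat_ge0//.
  apply: le_trans (flat_le _ _) _.
  rewrite -ler_pdivlMl// mulrC; near: h.
  by apply: dnbhs0_le; rewrite divr_gt0.
Unshelve. all: by end_near. Qed.

Lemma smooth_flat n : smooth_on setT (flat n).
Proof.
move=> k; elim: k n => [|k IH] n.
  move=> x _; apply: differentiable_continuous; apply/derivable1_diffP.
  by case: (is_derive_flat n x).
have dn x : derivable (flat n) x 1 by case: (is_derive_flat n x).
split=> [x v _|v]; first exact: derivableR.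
rewrite (_ : (fun x => _) =
    (fun x => v * (flat n.+2 x + - n%:R * flat n.+1 x))).
  apply: C_kM; first exact: smooth_on_cst.
  by apply: C_kD => //; apply: C_kM => //; exact: smooth_on_cst.
apply/funext => x; rewrite deriveR//; case: (is_derive_flat n x) => _ ->.
by rewrite mulNr.
Qed.

Lemma flat0_le1 t : t <= 1 -> flat 0 t <= expR (- 1).
Proof.
move=> t1; rewrite /flat; case: ifPn => t0; last exact: expR_ge0.
by rewrite expr0 mul1r ler_expR lerN2 -invr1 lef_pV2// posrE.
Qed.

Lemma flat0_ge1 t : 1 <= t -> expR (- 1) <= flat 0 t.
Proof.
move=> t1; rewrite /flat; have t0 : 0 < t by apply: lt_le_trans t1.
by rewrite t0 expr0 mul1r ler_expR lerN2 -invr1 lef_pV2// posrE.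
Qed.

(** Since [exp 1 * flat 0 t] is 0 for [t <= 0] and at least 1 for [t >= 1], the
    nested form is 0 in the first case and 1 in the second; composing rather than
    normalizing by a quotient leaves smoothness to the rules for products and
    compositions. *)
Definition step t := 1 - expR 1 * flat 0 (1 - expR 1 * flat 0 t).

Lemma smooth_step : smooth_on setT step.
Proof.
have s0 : smooth_on setT (fun t : R => 1 - expR 1 * flat 0 t).
  under eq_fun do rewrite -mulNr.
  apply: smooth_onD; first exact: smooth_on_cst.
  by apply: smooth_onZ; exact: smooth_flat.
exact: (smooth_on_comp s0 s0).
Qed.

Lemma step_le0 t : t <= 0 -> step t = 0.
Proof.
move=> t0; rewrite /step (flat_le0 _ t0) mulr0 subr0 /flat ltr01 expr0 invr1.
by rewrite mul1r -expRD subrr expR0 subrr.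
Qed.

Lemma step_ge1 t : 1 <= t -> step t = 1.
Proof.
move=> t1; rewrite /step [flat 0 (_ - _)]flat_le0 ?mulr0 ?subr0//.
rewrite subr_le0 -[leLHS]expR0 -(subrr (1:R)) expRD ler_pM2l ?expR_gt0//.
exact: flat0_ge1.
Qed.

Lemma step_ge0 t : 0 <= step t.
Proof.
rewrite subr_ge0 -[leRHS]expR0 -(subrr (1:R)) expRD ler_pM2l ?expR_gt0//.
by apply: flat0_le1; rewrite lerBlDr lerDl mulr_ge0 ?expR_ge0 ?flat_ge0.
Qed.

Lemma step_le1 t : step t <= 1.
Proof. by rewrite lerBlDr lerDl mulr_ge0 ?expR_ge0 ?flat_ge0. Qed.

Lemma derive_step_out t : (t < 0) || (1 < t) -> 'D_1 step t = 0.
Proof.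
case/orP => h.
- rewrite (@near_eq_derive _ _ _ _ (cst (0 : R))) ?derive_cst//.
  by near=> s; rewrite step_le0// ltW//; near: s; exact: lt_nbhsl.
- rewrite (@near_eq_derive _ _ _ _ (cst (1 : R))) ?derive_cst//.
  by near=> s; rewrite step_ge1// ltW//; near: s; exact: lt_nbhsr.
Unshelve. all: by end_near. Qed.

End FlatFunction.

#[global] Opaque step flat.

(** * Lower integrals *)
Section LowerIntegral.
Context d (T : measurableType d) (R : realType).
Variable mu : {measure set T -> \bar R}.
Local Open Scope ereal_scope.

Import HBNNSimple.

(** The integral of a nonnegative function is by definition the supremum of the
    integrals of the simple functions below it, whether or not the function is
    measurable. *)
Lemma ge0_le_integral_lower D (f g : T -> \bar R) :
  (forall x, D x -> 0 <= f x) -> (forall x, D x -> f x <= g x) ->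
  \int[mu]_(x in D) f x <= \int[mu]_(x in D) g x.
Proof.
move=> f0 fg.
have g0 x : D x -> 0 <= g x by move=> Dx; apply: le_trans (fg x Dx); exact: f0.
rewrite !ge0_integralE//; apply: le_ereal_sup => _ [h hf <-]; exists h => // x.
apply: le_trans (hf x) _; rewrite /patch; case: ifPn => // /set_mem.
exact: fg.
Qed.

(** To bound a lower integral from above it suffices to bound the integrals of
    the measurable functions below the integrand, for which the usual rules of
    integration hold. *)
Lemma integral_le_minorants D (f : T -> \bar R) (C : \bar R) : measurable D ->
  (forall x, D x -> 0 <= f x) ->
  (forall h : T -> \bar R, measurable_fun [set: T] h -> (forall x, 0 <= h x) ->
     (forall x, D x -> h x <= f x) -> \int[mu]_(x in D) h x <= C) ->
  \int[mu]_(x in D) f x <= C.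
Proof.
move=> mD f0 H; rewrite ge0_integralE//; apply: ge_ereal_sup => _ [h hf <-].
rewrite -integralT_nnsfun.
have -> : \int[mu]_x (h x)%:E = \int[mu]_(x in D) (h x)%:E.
  rewrite [RHS]integral_mkcond; apply: eq_integral => x _.
  rewrite /patch; case: ifPn => // xD; move: (hf x); rewrite /patch (negbTE xD).
  by move=> h0; apply/eqP; rewrite eq_le h0 lee_fin fun_ge0.
apply: H => [|x|x Dx].
- exact/measurable_EFinP/measurable_funP.
- by rewrite lee_fin fun_ge0.
- by apply: le_trans (hf x) _; rewrite /patch mem_set.
Qed.

End LowerIntegral.

(** * Affine change of variable for arbitrary integrands *)
Section AffineSubstitution.
Context {R : realType}.
Local Notation leb := (@lebesgue_measure R).
Local Open Scope ereal_scope.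

Definition affine (a b x : R) : R := (a * x + b)%R.

Lemma measurable_affine a b :
  measurable_fun setT (affine a b : measurableTypeR R -> measurableTypeR R).
Proof.
apply: measurable_funD; last exact: measurable_cst.
by apply: measurable_funM; [exact: measurable_cst|exact: measurable_id].
Qed.

Lemma affineVK (a b : R) : a != 0%R -> cancel (affine a^-1 (- (a^-1 * b))) (affine a b).
Proof. by move=> a0 x; rewrite /affine; field. Qed.

(** Both sides are measures in [A] that agree on half-open intervals, where the
    two signs of [a] are treated apart as the preimage reverses the ends. *)
Lemma lebesgue_measure_affine (a b : R) (A : set R) : a != 0%R -> measurable A ->
  leb A = `|a|%:E * leb (affine a b @^-1` A).
Proof.
move=> a0 mA.
pose L : measurableTypeR R -> measurableTypeR R := affine a b.
have mL : measurable_fun setT L := measurable_affine a b.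
have na0 : (0 <= `|a|)%R by [].
pose nu : {measure set (measurableTypeR R) -> \bar R} :=
  mscale (NngNum na0) (pushforward leb L).
rewrite (@lebesgue_measure_unique _ (nu mL))// => _ [[x y] _ <-].
rewrite -[RHS]/(`|a|%:E * leb (affine a b @^-1` `]x, y]%classic)).
have [alt0|agt0|a00] := ltgtP a 0%R; last by rewrite a00 eqxx in a0.
- rewrite (_ : affine a b @^-1` _ = `[((y - b) / a)%R, ((x - b) / a)%R[%classic).
    rewrite ltr0_norm// !lebesgue_measure_itv/= !lte_fin.
    rewrite ltr_nM2r ?invr_lt0// ltrD2r.
    case: ifPn => _; last by rewrite mule0.
    by rewrite -!EFinD -EFinM; congr EFin; field.
  apply/seteqP; split => z /=; rewrite !in_itv/= /affine ler_ndivrMr// ltr_ndivlMr//.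
    by move=> /andP[? ?]; apply/andP; split; lra.
  by move=> /andP[? ?]; apply/andP; split; lra.
- rewrite (_ : affine a b @^-1` _ = `]((x - b) / a)%R, ((y - b) / a)%R]%classic).
    rewrite gtr0_norm// !lebesgue_measure_itv/= !lte_fin.
    rewrite ltr_pM2r ?invr_gt0// ltrD2r.
    case: ifPn => _; last by rewrite mule0.
    by rewrite -!EFinD -EFinM; congr EFin; field.
  apply/seteqP; split => z /=; rewrite !in_itv/= /affine ler_pdivlMr// ltr_pdivrMr//.
    by move=> /andP[? ?]; apply/andP; split; lra.
  by move=> /andP[? ?]; apply/andP; split; lra.
Qed.

Lemma ge0_measurable_integral_affine (a b : R) (D : set R) (f : R -> \bar R) :
  a != 0%R -> measurable D -> measurable_fun setT f -> (forall x, 0 <= f x) ->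
  \int[leb]_(x in D) f x =
  `|a|%:E * \int[leb]_(x in affine a b @^-1` D) f (affine a b x).
Proof.
move=> a0 mD mf f0.
pose L : measurableTypeR R -> measurableTypeR R := affine a b.
have mL : measurable_fun setT L := measurable_affine a b.
have na0 : (0 <= `|a|)%R by [].
pose nu : {measure set (measurableTypeR R) -> \bar R} :=
  mscale (NngNum na0) (pushforward leb L).
transitivity (\int[nu mL]_(x in D) f x).
  apply: eq_measure_integral => A mA _ /=; exact: lebesgue_measure_affine.
rewrite /nu ge0_integral_mscale//=; last exact: measurable_funS mf.
by rewrite ge0_integral_pushforward//; exact: measurable_funS mf.
Qed.

Lemma measurable_preimage_affine (a b : R) (D : set R) : measurable D ->
  measurable (affine a b @^-1` D).
Proof.
by move=> mD; rewrite -[_ @^-1` _]setTI; exact: (measurable_affine a b).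
Qed.

(** Measurable minorants are transported by the substitution.  Applying the same
    inequality to the inverse substitution gives the converse. *)
Lemma ge0_integral_affine_le (a b : R) (D : set R) (f : R -> \bar R) :
  a != 0%R -> measurable D -> (forall x, 0 <= f x) ->
  \int[leb]_(x in D) f x <=
  `|a|%:E * \int[leb]_(x in affine a b @^-1` D) f (affine a b x).
Proof.
move=> a0 mD f0; apply: integral_le_minorants => // h mh h0 hf.
rewrite (ge0_measurable_integral_affine b a0 mD mh h0) lee_pmul2l ?lte_fin ?normr_gt0//.
by apply: ge0_le_integral_lower => // x Dx; exact: hf.
Qed.

Lemma ge0_integral_affine (a b : R) (D : set R) (f : R -> \bar R) :
  a != 0%R -> measurable D -> (forall x, 0 <= f x) ->
  \int[leb]_(x in D) f x =
  `|a|%:E * \int[leb]_(x in affine a b @^-1` D) f (affine a b x).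
Proof.
move=> a0 mD f0; apply/eqP; rewrite eq_le ge0_integral_affine_le//=.
have aV0 : (a^-1 != 0)%R by rewrite invr_eq0.
have na0 : (0 < `|a|)%R by rewrite normr_gt0.
have := @ge0_integral_affine_le a^-1%R (- (a^-1 * b))%R _ (f \o affine a b) aV0
  (measurable_preimage_affine a b mD) (fun x => f0 _).
rewrite -(@lee_pmul2l _ (`|a|%R)%:E)//.
move=> /le_trans; apply; rewrite muleA -EFinM normfV divff ?gt_eqF// mul1e.
rewrite (_ : _ @^-1` _ = D); last first.
  by apply/seteqP; split => x /=; rewrite affineVK.
by apply: ge0_le_integral_lower => x Dx /=; rewrite affineVK.
Qed.

Lemma integral_affine (a b : R) (D : set R) (f : R -> \bar R) :
  a != 0%R -> measurable D ->
  \int[leb]_(x in D) f x =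
  `|a|%:E * \int[leb]_(x in affine a b @^-1` D) f (affine a b x).
Proof.
move=> a0 mD; rewrite [LHS]integralE [X in _ * X]integralE.
rewrite (@ge0_integral_affine a b D (f^\+) a0 mD); last by move=> x; exact: funepos_ge0.
rewrite (@ge0_integral_affine a b D (f^\-) a0 mD); last by move=> x; exact: funeneg_ge0.
have Ep : \int[leb]_(x in affine a b @^-1` D) (fun x => f (affine a b x))^\+ x =
    \int[leb]_(x in affine a b @^-1` D) f^\+ (affine a b x).
  by apply: eq_integral => x _; rewrite !funeposE.
have En : \int[leb]_(x in affine a b @^-1` D) (fun x => f (affine a b x))^\- x =
    \int[leb]_(x in affine a b @^-1` D) f^\- (affine a b x).
  by apply: eq_integral => x _; rewrite !funenegE.
rewrite Ep En {Ep En}.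
have : 0 <= \int[leb]_(x in affine a b @^-1` D) f^\+ (affine a b x).
  exact: integral_ge0.
have : 0 <= \int[leb]_(x in affine a b @^-1` D) f^\- (affine a b x).
  exact: integral_ge0.
move: (integral _ _ _) (integral _ _ _) => x y.
have na0 : (0 < `|a|)%R by rewrite normr_gt0.
case: x => [x| |]//; case: y => [y| |]// _ _;
  rewrite ?gt0_muley ?lte_fin// -?EFinN -?EFinM -?EFinD -?EFinM ?mulrBr//=;
  rewrite ?gt0_muley ?gt0_muleNy ?lte_fin//=.
Qed.

Lemma integral_unit_affine (s l : R) (f : R -> \bar R) : (0 < l)%R ->
  \int[leb]_(t in `[s, (s + l)%R]) f ((t - s) / l)%R =
  l%:E * \int[leb]_(t in `[0%R, 1%R]) f t.
Proof.
move=> l0; rewrite (@integral_affine l s _ (fun t => f ((t - s) / l)%R)) ?gt_eqF//.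
rewrite gtr0_norm//; congr (_ * _).
rewrite (_ : affine l s @^-1` _ = `[0%R, 1%R]%classic).
  by apply: eq_integral => x _; rewrite /affine addrK mulrAC divff ?mul1r// gt_eqF.
apply/seteqP; split => z /=; rewrite !in_itv/= /affine lerDr (addrC s) lerD2r.
  by rewrite pmulr_rge0// ger_pMr.
by rewrite pmulr_rge0// ger_pMr.
Qed.

Lemma integral_unit_reverse (f : R -> \bar R) :
  \int[leb]_(t in `[0%R, 1%R]) f (1 - t)%R = \int[leb]_(t in `[0%R, 1%R]) f t.
Proof.
rewrite (@integral_affine (-1)%R 1%R _ f) ?oppr_eq0 ?oner_eq0// normrN1 mul1e.
rewrite (_ : affine _ _ @^-1` _ = `[0%R, 1%R]%classic).
  by apply: eq_integral => x _; rewrite /affine mulN1r addrC.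
by apply/seteqP; split => z /=; rewrite !in_itv/= /affine mulN1r => /andP[? ?];
  apply/andP; split; lra.
Qed.

End AffineSubstitution.

(** * Homogeneity of the integral without measurability *)
Section LowerScaling.
Context d (T : measurableType d) (R : realType).
Variable mu : {measure set T -> \bar R}.
Local Open Scope ereal_scope.

(** Multiplication by [k] maps minorants of [f] to minorants of [k * f]; the
    converse inequality is the same one for [k^-1]. *)
Lemma ge0_integralZl_lower D (f : T -> \bar R) (k : R) : measurable D ->
  (forall x, D x -> 0 <= f x) -> (0 <= k)%R ->
  \int[mu]_(x in D) (k%:E * f x) = k%:E * \int[mu]_(x in D) f x.
Proof.
have le (f' : T -> \bar R) (c : R) : measurable D -> (forall x, D x -> 0 <= f' x) ->
    (0 < c)%R ->
    \int[mu]_(x in D) (c%:E * f' x) <= c%:E * \int[mu]_(x in D) f' x.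
  move=> mD f0 c0; apply: integral_le_minorants => //.
    by move=> x Dx; rewrite mule_ge0 ?f0// lee_fin ltW.
  move=> h mh h0 hf; rewrite -lee_pdivrMl//.
  rewrite -ge0_integralZl_EFin//; last 2 first.
  - exact: measurable_funS mh.
  - by rewrite invr_ge0 ltW.
  apply: ge0_le_integral_lower => x Dx.
    by rewrite mule_ge0// lee_fin invr_ge0 ltW.
  by rewrite lee_pdivrMl// hf.
move=> mD f0; rewrite le_eqVlt => /predU1P[<-|k0].
  by under eq_integral do rewrite mul0e; rewrite integral0 mul0e.
apply/eqP; rewrite eq_le le//= -lee_pdivlMl//.
apply: le_trans (le (fun x => k%:E * f x) _ mD _ _); last 2 first.
- by move=> x Dx; rewrite mule_ge0 ?f0// lee_fin ltW.
- by rewrite invr_gt0.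
rewrite le_eqVlt; apply/orP; left; apply/eqP; apply: eq_integral => x _.
by rewrite muleA -EFinM mulVf ?mul1e// gt_eqF.
Qed.

(** Swapping the two parts of an infinite-minus-infinite integral does not negate
    its value in the extended reals, but [fine] maps both infinities to 0 and so
    restores oddness. *)
Lemma fine_subeC (x y : \bar R) : 0 <= x -> 0 <= y ->
  fine (x - y) = (- fine (y - x))%R.
Proof.
by case: x => [x| |]//; case: y => [y| |]//= _ _; rewrite ?oppr0// opprB.
Qed.

Lemma RintegralN_lower D (f : T -> R) :
  (\int[mu]_(x in D) (- f x) = - \int[mu]_(x in D) f x)%R.
Proof.
rewrite /Rintegral integralE [in RHS]integralE -fine_subeC//; last 2 first.
- exact: integral_ge0.
- exact: integral_ge0.
congr (fine (_ - _)); apply: eq_integral => x _;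
  by rewrite funeposE funenegE/= ?opprK.
Qed.

(** The real-valued integral is [fine] of the difference of two lower integrals,
    and both steps commute with scaling. *)
Lemma RintegralZl_lower D (f : T -> R) (k : R) : measurable D ->
  (\int[mu]_(x in D) (k * f x) = k * \int[mu]_(x in D) f x)%R.
Proof.
move=> mD.
have pos (c : R) : (0 < c)%R ->
    (\int[mu]_(x in D) (c * f x) = c * \int[mu]_(x in D) f x)%R.
  move=> c0; rewrite /Rintegral integralE [in RHS]integralE.
  have -> : \int[mu]_(x in D) (fun x => (c * f x)%:E)^\+ x =
      c%:E * \int[mu]_(x in D) (EFin \o f)^\+ x.
    rewrite -ge0_integralZl_lower ?(ltW c0)//.
    apply: eq_integral => x _; rewrite !funeposE/= -EFin_max.
    by rewrite -EFin_max -EFinM maxr_pMr ?(ltW c0)// mulr0.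
  have -> : \int[mu]_(x in D) (fun x => (c * f x)%:E)^\- x =
      c%:E * \int[mu]_(x in D) (EFin \o f)^\- x.
    rewrite -ge0_integralZl_lower ?(ltW c0)//.
    apply: eq_integral => x _; rewrite !funenegE/= -EFin_max.
    by rewrite -EFin_max -EFinM maxr_pMr ?(ltW c0)// mulr0 mulrN.
  have : 0 <= \int[mu]_(x in D) (EFin \o f)^\+ x by exact: integral_ge0.
  have : 0 <= \int[mu]_(x in D) (EFin \o f)^\- x by exact: integral_ge0.
  move: (integral _ _ _) (integral _ _ _) => x y.
  case: x => [x| |]//; case: y => [y| |]//= _ _;
  rewrite ?gt0_muley ?gt0_muleNy ?lte_fin//= ?mulr0// mulrBr//.
have [k0|k0|->] := ltgtP k 0%R.
- have := pos (- k)%R; rewrite oppr_gt0 => /(_ k0).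
  rewrite (_ : (fun x => _) = (fun x => - (k * f x))%R); last first.
    by apply/funext => x; rewrite mulNr.
  by rewrite RintegralN_lower mulNr => /oppr_inj.
- exact: pos.
- rewrite mul0r /Rintegral.
  by under eq_integral do rewrite mul0r; rewrite integral0.
Qed.

End LowerScaling.

Section RintegralAffine.
Context {R : realType}.
Local Notation leb := (@lebesgue_measure R).

Lemma Rintegral_unit_affine (s l : R) (f : R -> R) : 0 < l ->
  \int[leb]_(t in `[s, s + l]) f ((t - s) / l) =
  l * \int[leb]_(t in `[0, 1]) f t.
Proof.
move=> l0; rewrite /Rintegral (@integral_unit_affine _ s l (EFin \o f) l0).
have := l0; case: (integral _ _ _) => [x| |]//= _.
- by rewrite gt0_muley ?lte_fin//= mulr0.
- by rewrite gt0_muleNy ?lte_fin//= mulr0.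
Qed.

Lemma Rintegral_unit_reverse (f : R -> R) :
  \int[leb]_(t in `[0, 1]) f (1 - t) = \int[leb]_(t in `[0, 1]) f t.
Proof. by rewrite /Rintegral (integral_unit_reverse (EFin \o f)). Qed.

End RintegralAffine.

(** * Measurability of continuous functions on the plane *)
Section ProductMeasurability.
Context {R : realType}.

(** An open set is the countable union of the boxes with rational corners that it
    contains, and boxes are measurable for the product structure. *)
Lemma open_measurable_plane (A : set (R * R)) : open A -> measurable A.
Proof.
move=> oA.
pose box (q : rat * rat * rat * rat) : set (R * R) :=
  `]ratr q.1.1.1, ratr q.1.1.2[%classic `*` `]ratr q.1.2, ratr q.2[%classic.
have -> : A = \bigcup_q (if `[< box q `<=` A >] then box q else set0).
  apply/seteqP; split=> [[t x] Atx|z [q _]]; last first.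
    by case: ifPn => // /asboolP; exact.
  have /nbhs_ballP[e /= e0 eA] : nbhs (t, x) A by exact: open_nbhs_nbhs.
  have [q1 q1i] := @rat_in_itvoo R (t - e) t (ltac:(by rewrite ltrBlDr ltrDl)).
  have [q2 q2i] := @rat_in_itvoo R t (t + e) (ltac:(by rewrite ltrDl)).
  have [q3 q3i] := @rat_in_itvoo R (x - e) x (ltac:(by rewrite ltrBlDr ltrDl)).
  have [q4 q4i] := @rat_in_itvoo R x (x + e) (ltac:(by rewrite ltrDl)).
  move: q1i q2i q3i q4i; rewrite !in_itv/= => /andP[? ?] /andP[? ?] /andP[? ?] /andP[? ?].
  exists (q1, q2, q3, q4) => //; case: ifPn => [_|/asboolP].
    by split; rewrite /= in_itv/=; apply/andP.
  case=> -[t' x'] [/=]; rewrite !in_itv/= => /andP[? ?] /andP[? ?].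
  by apply: eA; split; rewrite /ball/= ltr_norml; apply/andP; split; lra.
apply: countable_bigcupT_measurable; first exact: countableP.
move=> q; case: ifPn => // _; apply: measurableX; exact: measurable_itv.
Qed.

Lemma continuous_measurable_plane (f : R * R -> R) :
  continuous f -> measurable_fun setT f.
Proof.
move=> cf; apply: (@measurability _ _ _ _ setT f _ (RGenOInfty.measurableE R)).
move=> _ [_ [a ->] <-]; rewrite setTI.
apply: open_measurable_plane.
apply: open_comp; first by move=> z _; exact: cf.
exact: interval_open.
Qed.

End ProductMeasurability.

(** * Cut-offs in time *)
Section Ramp.
Context {R : realType}.
Implicit Types (k t : R).

Lemma derive_flat0_ge0 t : 0 <= 'D_1 (flat 0) t.
Proof.
case: (is_derive_flat 0 t) => _ ->.
by rewrite mul0r subr0 flat_ge0.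
Qed.

(** The step is a composition of two nonincreasing functions. *)
Lemma derive_step_ge0 t : 0 <= 'D_1 (@step R) t.
Proof.
pose h (t : R) := 1 - expR 1 * flat 0 t.
have dh (u : R) : is_derive u 1 h (- (expR 1 * 'D_1 (flat 0) u)).
  have df := is_derive_smooth u (smooth_flat 0).
  by apply: is_derive_eq; rewrite add0r mul1r.
have [_ ->] := is_derive1_comp (dh (h t)) (dh t).
by rewrite mulrNN !mulr_ge0 ?expR_ge0 ?derive_flat0_ge0.
Qed.

(** Vanishes up to time [1 / k] and equals 1 from time [2 / k] on: a test function
    of time must vanish in a neighbourhood of the end time, not only at it. *)
Definition ramp k t : R := step (k * t - 1).

Lemma smooth_ramp k : smooth_on setT (ramp k).
Proof. exact: (smooth_on_affineR k (-1) smooth_step). Qed.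

Lemma derive_ramp k t : 'D_1 (ramp k) t = k * 'D_1 step (k * t - 1).
Proof. exact: (derive_affineR k (-1) t smooth_step). Qed.

Lemma ramp_ge0 k t : 0 <= ramp k t. Proof. exact: step_ge0. Qed.
Lemma ramp_le1 k t : ramp k t <= 1. Proof. exact: step_le1. Qed.

Lemma ramp0 k t : k * t <= 1 -> ramp k t = 0.
Proof. by move=> h; rewrite /ramp step_le0// subr_le0. Qed.

Lemma ramp1 k t : 2 <= k * t -> ramp k t = 1.
Proof. by move=> h; rewrite /ramp step_ge1//; lra. Qed.

Lemma derive_ramp_ge0 k t : 0 <= k -> 0 <= 'D_1 (ramp k) t.
Proof. by move=> k0; rewrite derive_ramp mulr_ge0 ?derive_step_ge0. Qed.

Lemma derive_ramp_out k t : 2 < k * t -> 'D_1 (ramp k) t = 0.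
Proof.
by move=> h; rewrite derive_ramp derive_step_out ?mulr0//; apply/orP; right; lra.
Qed.

#[global] Opaque ramp.

Definition cutoff k a b t : R := ramp k (t - a) * ramp k (b - t).

Lemma smooth_rampB k b : smooth_on setT (fun t => ramp k (b - t)).
Proof.
rewrite (_ : (fun t => _) = (fun t => ramp k (-1 * t + b))).
  by apply: smooth_on_affineR; exact: smooth_ramp.
by apply/funext => t; rewrite mulN1r addrC.
Qed.

Lemma smooth_cutoff k a b : smooth_on setT (cutoff k a b).
Proof.
apply: smooth_onM; last exact: smooth_rampB.
rewrite (_ : (fun t => _) = (fun t => ramp k (1 * t + - a))).
  by apply: smooth_on_affineR; exact: smooth_ramp.
by apply/funext => t; rewrite mul1r.
Qed.

Lemma cutoff_ge0 k a b t : 0 <= cutoff k a b t.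
Proof. by rewrite mulr_ge0 ?ramp_ge0. Qed.

Lemma cutoff_le1 k a b t : cutoff k a b t <= 1.
Proof. by rewrite mulr_ile1 ?ramp_ge0 ?ramp_le1. Qed.

Lemma cutoff_out k a b t : 0 < k -> (t <= a + k^-1) || (b - k^-1 <= t) ->
  cutoff k a b t = 0.
Proof.
move=> k0 /orP[h|h]; rewrite /cutoff.
  by rewrite ramp0 ?mul0r// -ler_pdivlMl// mulr1; lra.
by rewrite (@ramp0 _ (b - t)) ?mulr0// -ler_pdivlMl// mulr1; lra.
Qed.

Lemma nbhs_inftyS_ger (r : R) : \forall n \near \oo, r <= n.+1%:R.
Proof.
near=> n; rewrite (@le_trans _ _ n%:R)// ?ler_nat// ltW//.
by near: n; exact: nbhs_infty_gtr.
Unshelve. all: by end_near. Qed.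

Lemma cutoff_cvg a b t :
  cutoff n.+1%:R a b t @[n --> \oo] --> (\1_(`]a, b[%classic) t : R).
Proof.
have [tab|tab] := boolP (t \in `]a, b[).
  rewrite indicE mem_set//=; apply: cvg_near_cst.
  move: tab; rewrite in_itv/= => /andP[at_ tb].
  have ta0 : 0 < t - a by rewrite subr_gt0.
  have bt0 : 0 < b - t by rewrite subr_gt0.
  near=> n; rewrite /cutoff !ramp1 ?mulr1//.
  - by rewrite -ler_pdivrMr//; near: n; exact: nbhs_inftyS_ger.
  - by rewrite -ler_pdivrMr//; near: n; exact: nbhs_inftyS_ger.
rewrite indicE memNset//=; last by move=> /= h; rewrite h in tab.
apply: cvg_near_cst; apply: nearW => n; rewrite cutoff_out ?ltr0n//.
move: tab; rewrite in_itv/= negb_and -!leNgt => /orP[h|h]; apply/orP; [left|right].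
  by apply: le_trans h _; rewrite lerDl invr_ge0 ler0n.
by apply: le_trans h; rewrite gerBl invr_ge0 ler0n.
Unshelve. all: by end_near. Qed.

Lemma derive_mul_reverse (f : R -> R) t : smooth_on setT f ->
  'D_1 (fun s : R => f s * f (1 - s)) t =
  f (1 - t) * 'D_1 f t - f t * 'D_1 f (1 - t).
Proof.
move=> sf.
have E : (fun s => f (1 - s)) = (fun s => f (-1 * s + 1)).
  by apply/funext => s; rewrite mulN1r addrC.
have sf' : smooth_on setT (fun s : R => f (1 - s)).
  by rewrite E; exact: smooth_on_affineR.
rewrite (smooth_on_deriveM t 1 sf sf') addrC; congr (_ + _).
rewrite E derive_affineR// mulN1r mulrN; congr (- (_ * 'D_1 f _)).
by rewrite mulN1r addrC.
Qed.

(** For [k >= 5] the two transition layers are disjoint, so on the layer of one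
    factor the other factor is 1. *)
Lemma derive_cutoff01 k t : 5 <= k ->
  'D_1 (cutoff k 0 1) t = 'D_1 (ramp k) t - 'D_1 (ramp k) (1 - t).
Proof.
move=> k5.
have k0 : 0 < k by lra.
have -> : cutoff k 0 1 = (fun s : R => ramp k s * ramp k (1 - s)).
  by apply/funext => s; rewrite /cutoff subr0.
rewrite derive_mul_reverse; last exact: smooth_ramp.
congr (_ - _).
  have [h|h] := leP (k * t) 2; last by rewrite derive_ramp_out ?mulr0.
  by rewrite ramp1 ?mul1r//; lra.
have [h|h] := leP (k * (1 - t)) 2; last by rewrite derive_ramp_out ?mulr0.
by rewrite ramp1 ?mul1r//; lra.
Qed.

End Ramp.

(** * Weak derivatives and end point values *)
Section DuBoisReymond.
Context {R : realType}.
Local Notation leb := (@lebesgue_measure R).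
Implicit Types (a G f : R -> R).

Lemma within_continuousM (A : set R) (f g : R -> R) :
  {within A, continuous f} -> {within A, continuous g} ->
  {within A, continuous (fun t => f t * g t)}.
Proof.
by move=> cf cg t; apply: (@continuousM R (subspace A) f g); [exact: cf|exact: cg].
Qed.

Lemma within_continuousB (A : set R) (f g : R -> R) :
  {within A, continuous f} -> {within A, continuous g} ->
  {within A, continuous (fun t => f t - g t)}.
Proof.
by move=> cf cg t; apply: (@continuousB R R (subspace A) f g); [exact: cf|exact: cg].
Qed.

Lemma within_continuous_norm (A : set R) (f : R -> R) :
  {within A, continuous f} -> {within A, continuous (fun t => `|f t|)}.
Proof. by move=> cf t; apply: cvg_norm; exact: cf. Qed.

Lemma Rintegral_dominated_cvg d (T : measurableType d)
    (mu : {measure set T -> \bar R}) (D : set T) (f_ : nat -> T -> R)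
    (f g : T -> R) : measurable D ->
  (forall n, measurable_fun D (f_ n)) ->
  (forall x, D x -> f_ n x @[n --> \oo] --> f x) ->
  mu.-integrable D (EFin \o g) ->
  (forall n x, D x -> `|f_ n x| <= g x) ->
  \int[mu]_(x in D) f_ n x @[n --> \oo] --> \int[mu]_(x in D) f x.
Proof.
move=> mD mf_ cf ig fg.
have mf : measurable_fun D f by exact: measurable_fun_cvg mf_ cf.
have [] := @dominated_convergence _ T R mu D mD (fun n => EFin \o f_ n)
  (EFin \o f) (EFin \o g).
- by move=> n; exact/measurable_EFinP.
- exact/measurable_EFinP.
- apply: aeW => x Dx /=; apply: cvg_EFin; first exact: nearW.
  exact: cf.
- exact: ig.
- by apply: aeW => x n Dx /=; rewrite lee_fin; exact: fg.
move=> if_ _ h; apply: fine_cvg; rewrite fineK//.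
exact: integrable_fin_num.
Qed.

Lemma integrable_within_continuous x y f : {within `[x, y], continuous f} ->
  leb.-integrable `[x, y] (EFin \o f).
Proof.
by move=> cf; apply: continuous_compact_integrable => //; exact: segment_compact.
Qed.

Lemma Rintegral_derive x y f : x < y -> smooth_on setT f ->
  \int[leb]_(t in `[x, y]) 'D_1 f t = f y - f x.
Proof.
move=> xy sf; rewrite /Rintegral (@continuous_FTC2 _ (fun t => 'D_1 f t) f)//=.
- apply: continuous_subspaceT.
  by have := (smooth_on_continuous (smooth_on_derive (1:R) sf)); apply.
- split.
  + by move=> t _; exact: smooth_on_derivable.
  + by apply: cvg_at_right_filter; have := smooth_on_continuous sf; apply.
  + by apply: cvg_at_left_filter; have := smooth_on_continuous sf; apply.
- by move=> t _; rewrite derive1E.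
Qed.

(** The derivatives of the ramps are nonnegative, have integral 1 over the
    unit interval and vanish after time [2 / k]: they are an approximation of the Dirac
    mass at the end point 0. *)
Lemma ramp_concentrates a : {within `[0, 1], continuous a} ->
  \int[leb]_(t in `[0, 1]) ('D_1 (ramp n.+1%:R) t * a t) @[n --> \oo] --> a 0.
Proof.
move=> ca; apply/cvgrPdist_le => e e0.
have c0 : a t @[t --> within `[0, 1] (nbhs (0:R))] --> a 0.
  by move/subspace_continuousP : ca; apply; rewrite /= in_itv/= lexx ler01.
move/cvgrPdist_le : c0 => /(_ e e0) /nbhs_ballP[d /= d0 ad].
near=> n; pose r' (t : R) : R := 'D_1 (ramp n.+1%:R) t.
rewrite -[X in `|a 0 - X|]/(\int[leb]_(t in `[0, 1]) (r' t * a t)).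
have cr' : continuous r'.
  by have := smooth_on_continuous (smooth_on_derive (1:R) (@smooth_ramp R n.+1%:R)); apply.
have n2 : 2 <= n.+1%:R :> R by near: n; exact: nbhs_inftyS_ger.
have ir' : \int[leb]_(t in `[0, 1]) r' t = 1.
  rewrite Rintegral_derive//; last exact: smooth_ramp.
  by rewrite ramp1 ?mulr1// ramp0 ?mulr0// subr0.
have cr'a : {within `[0, 1], continuous (fun t => r' t * a t)}.
  by apply: within_continuousM => //; exact: continuous_subspaceT.
have mI : measurable (`[0, 1]%classic : set R) by exact: measurable_itv.
have cst_r' c : {within `[0, 1], continuous (fun t => r' t * c)}.
  apply: continuous_subspaceT => t; apply: continuousM; first exact: cr'.
  exact: cst_continuous.
have ic c : \int[leb]_(t in `[0, 1]) (r' t * c) = c.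
  under eq_Rintegral do rewrite mulrC.
  by rewrite RintegralZl_lower// ir' mulr1.
rewrite -{1}(ic (a 0)) -RintegralB//; try exact: integrable_within_continuous.
apply: le_trans (le_normr_Rintegral _ _) _ => //.
  by apply: integrable_within_continuous; exact: within_continuousB.
rewrite -[leRHS](ic e); apply: le_Rintegral => //.
- apply: integrable_within_continuous; apply: within_continuous_norm.
  exact: within_continuousB.
- exact: integrable_within_continuous.
- move=> t; rewrite /= in_itv/= => /andP[t0 t1].
  have r'0 : 0 <= r' t by rewrite derive_ramp_ge0.
  rewrite -mulrBr normrM ger0_norm//.
  have [h|h] := leP (n.+1%:R * t) 2; last by rewrite /r' derive_ramp_out// !mul0r.
  rewrite ler_wpM2l//; apply: ad; last by rewrite /= in_itv/= t0.
  rewrite /ball/= sub0r normrN ger0_norm//.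
  have {}h : t <= 2 / n.+1%:R by rewrite ler_pdivlMr ?ltr0n// mulrC.
  apply: le_lt_trans h _; rewrite ltr_pdivrMr ?ltr0n// mulrC -ltr_pdivrMr//.
  have : 2 / d + 1 <= n.+1%:R by near: n; exact: nbhs_inftyS_ger.
  by apply: lt_le_trans; rewrite ltrDl.
Unshelve. all: by end_near. Qed.

Lemma within_unit_reverse (a : R -> R) : {within `[0, 1], continuous a} ->
  {within `[0, 1], continuous (fun t => a (1 - t))}.
Proof.
move=> /subspace_continuousP ca; apply/subspace_continuousP => t /= t01.
apply: (@cvg_comp _ _ _ (fun t : R => 1 - t) a _ (within `[0, 1] (nbhs (1 - t)))).
  move=> A /= wA.
  have : \forall s \near (1 - t : R), (`[0, 1]%classic : set R) s -> A s by [].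
  have c : {for t, continuous (fun t : R => 1 - t)}.
    by apply: continuousB; [exact: cst_continuous|exact: cvg_id].
  move=> /c; rewrite /= !near_simpl; apply: filterS => s h s01; apply: h.
  by move: s01; rewrite /= !in_itv/= => /andP[? ?]; apply/andP; split; lra.
by apply: ca; move: t01; rewrite /= !in_itv/= => /andP[? ?]; apply/andP; split; lra.
Qed.

(** The fundamental theorem of calculus for a weak derivative [G] of a continuous
    function [a].  Taking for [eta] cut-offs of the unit interval, the first integral tends to
    [a 0 - a 1] by concentration at both ends, the second one to the integral of
    [G] by dominated convergence. *)
Lemma weak_derivative_increment a G : {within `[0, 1], continuous a} ->
  leb.-integrable `[0, 1] (EFin \o G) ->
  (forall (eta : R -> R) (c d : R), smooth_on setT eta -> 0 < c -> d < 1 ->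
    (forall t, (t <= c) || (d <= t) -> eta t = 0) ->
    \int[leb]_(t in `[0, 1]) ('D_1 eta t * a t) +
    \int[leb]_(t in `[0, 1]) (eta t * G t) = 0) ->
  \int[leb]_(t in `[0, 1]) G t = a 1 - a 0.
Proof.
move=> ca iG weak.
(* The shift makes k n >= 5, so that the layers at 0 and 1 are disjoint. *)
pose k n : R := (n + 4).+1%:R.
have mI : measurable (`[0, 1]%classic : set R) by exact: measurable_itv.
have k5 n : 5 <= k n by rewrite /k ler_nat !ltnS leq_addl.
have k0 n : 0 < k n by rewrite /k ltr0n.
have cr' n : {within `[0, 1], continuous (fun t => 'D_1 (ramp (k n)) t)}.
  apply: continuous_subspaceT.
  by have := smooth_on_continuous (smooth_on_derive (1:R) (@smooth_ramp R (k n))); apply.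
have car := within_unit_reverse ca.
pose u n : R := \int[leb]_(t in `[0, 1]) ('D_1 (ramp n.+1%:R) t * a t).
pose v n : R := \int[leb]_(t in `[0, 1]) ('D_1 (ramp n.+1%:R) t * a (1 - t)).
pose g n : R := \int[leb]_(t in `[0, 1]) (cutoff n.+1%:R 0 1 t * G t).
(* The derivative of the cut-off is that of a ramp at 0 minus that of its
   mirror image at 1; the latter is turned into v by reversing time. *)
have uvg n : u (n + 4)%N - v (n + 4)%N + g (n + 4)%N = 0.
  rewrite -(weak (cutoff (k n) 0 1) (k n)^-1 (1 - (k n)^-1)).
  - congr (_ + _); rewrite -[v _]Rintegral_unit_reverse.
    under [X in _ - X]eq_Rintegral do rewrite subKr.
    rewrite -RintegralB//; last 2 first.
    + by apply: integrable_within_continuous; apply: within_continuousM; [exact: cr'|].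
    + apply: integrable_within_continuous; apply: within_continuousM => //.
      exact: (within_unit_reverse (cr' n)).
    by apply: eq_Rintegral => t _; rewrite -mulrBl derive_cutoff01.
  - exact: smooth_cutoff.
  - by rewrite invr_gt0.
  - by rewrite ltrBlDr ltrDl invr_gt0.
  - by move=> t h; apply: cutoff_out; rewrite ?add0r.
have cu : u (n + 4)%N @[n --> \oo] --> a 0.
  by rewrite (cvg_shiftn 4 u); exact: ramp_concentrates.
have cv : v (n + 4)%N @[n --> \oo] --> a 1.
  rewrite (cvg_shiftn 4 v) -[X in _ --> a X]subr0.
  exact: (ramp_concentrates car).
have cg : g (n + 4)%N @[n --> \oo] --> \int[leb]_(t in `[0, 1]) G t.
  rewrite (cvg_shiftn 4 g).
  pose I01 : set R := `[0, 1]%classic.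
  have mG : measurable_fun I01 G by apply/measurable_EFinP; exact: measurable_int iG.
  have Ioo (f : R -> R) : measurable_fun I01 f ->
      \int[leb]_(t in `[0, 1]) f t = \int[leb]_(t in `]0, 1[) f t.
    move=> mf; rewrite /Rintegral integral_itv_bndoo//; apply/measurable_EFinP.
    by apply: measurable_funS mf => //; exact: subset_itv_oo_cc.
  have mc n : measurable_fun I01 (fun t => cutoff n.+1%:R 0 1 t * G t).
    apply: measurable_funM => //; apply: measurable_funTS.
    by apply: continuous_measurable_fun; apply: smooth_on_continuous; exact: smooth_cutoff.
  rewrite (_ : g = fun n => \int[leb]_(t in `]0, 1[) (cutoff n.+1%:R 0 1 t * G t)); last first.
    by apply/funext => n; rewrite -Ioo.
  rewrite (Ioo G mG).
  apply: (@Rintegral_dominated_cvg _ _ leb (`]0, 1[%classic : set R)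
    (fun n t => cutoff n.+1%:R 0 1 t * G t) G (fun t => `|G t|)).
  - exact: measurable_itv.
  - by move=> n; apply: measurable_funS (mc n) => //; exact: subset_itv_oo_cc.
  - move=> t t01; rewrite -[X in _ --> X]mul1r; apply: cvgM; last exact: cvg_cst.
    have := @cutoff_cvg R 0 1 t; rewrite indicE mem_set//.
  - apply: integrable_norm; apply: integrableS iG => //; exact: subset_itv_oo_cc.
  - move=> n t _; rewrite normrM ger0_norm ?cutoff_ge0// ler_piMl//.
    exact: cutoff_le1.
have h : u (n + 4)%N - v (n + 4)%N + g (n + 4)%N @[n --> \oo] -->
    (a 0 - a 1 + \int[leb]_(t in `[0, 1]) G t).
  by apply: cvgD => //; exact: cvgB.
have {}h : a 0 - a 1 + \int[leb]_(t in `[0, 1]) G t = 0.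
  rewrite -(cvg_lim (@Rhausdorff R) h); under eq_fun do rewrite uvg.
  exact: lim_cst.
lra.
Qed.

End DuBoisReymond.

(** * Pairing a curve with a function of time and space *)
Lemma closure_sub_closed (T : topologicalType) (A B : set T) :
  closed B -> A `<=` B -> closure A `<=` B.
Proof. by move=> /closure_id cB AB; rewrite cB; exact: closure_subset. Qed.

Section SpatialSupport.
Context {R : realType}.
Local Notation leb := (@lebesgue_measure R).
Implicit Types (f : R * R -> R) (r : R).

(** Unlike a test function, such an [f] is not restricted in time. *)
Definition spatially_supported r f := forall t x, r < `|x| -> f (t, x) = 0.

Lemma integrable_supported (g : R -> R) r (C : R) : measurable_fun setT g ->
  (forall x, `|g x| <= C) -> (forall x, r < `|x| -> g x = 0) ->
  leb.-integrable setT (EFin \o g).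
Proof.
move=> mg gC g0.
have E : EFin \o g = (EFin \o g) \_ (`[- r, r]%classic : set R).
  apply/funext => x; rewrite patchE; case: ifPn => // /negP h /=.
  by rewrite g0// ltNge ler_norml; apply/negP => h'; apply: h; rewrite inE/= in_itv.
rewrite E; apply/(integrable_mkcond _ _).1; first exact: measurable_itv.
apply: measurable_bounded_integrable.
- exact: measurable_itv.
- by apply: compact_finite_measure; exact: segment_compact.
- exact: measurable_funTS.
- exists C; split; first exact: num_real.
  by move=> M CM x _ /=; apply: le_trans (gC x) (ltW CM).
Qed.

Lemma Rintegral_supported_le (g : R -> R) r (C : R) : measurable_fun setT g ->
  (forall x, `|g x| <= C) -> (forall x, r < `|x| -> g x = 0) ->
  `|\int[leb]_x g x| <= C * fine (leb (`[- r, r]%classic : set R)).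
Proof.
move=> mg gC g0; have ig := integrable_supported mg gC g0.
have mI : measurable (`[- r, r]%classic : set R) by exact: measurable_itv.
apply: le_trans (le_normr_Rintegral _ ig) _ => //.
rewrite -(Rintegral_cst leb mI).
have -> : \int[leb]_x `|g x| = \int[leb]_(x in `[- r, r]) `|g x|.
  rewrite [RHS]Rintegral_mkcond; apply: eq_Rintegral => x _.
  rewrite patchE; case: ifPn => // /negP h /=.
  by rewrite g0 ?normr0// ltNge ler_norml; apply/negP => h'; apply: h; rewrite inE/= in_itv.
apply: le_Rintegral => //.
- by apply: integrable_norm; apply: integrableS ig.
- apply: integrable_within_continuous; apply: continuous_subspaceT => x.
  exact: cst_continuous.
Qed.

Lemma spatially_supported_bounded f r : continuous f ->
  spatially_supported r f ->
  exists C : R, 0 <= C /\ forall t x : R, `[0, 1]%classic t -> `|f (t, x)| <= C.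
Proof.
move=> cf fr.
pose K : set (R * R) := `[0, 1]%classic `*` `[- r, r]%classic.
have cK : compact (f @` K).
  apply: continuous_compact; first exact: continuous_subspaceT.
  by apply: compact_setX; exact: segment_compact.
have [M [_ HM]] := compact_bounded cK.
exists (`|M| + 1); split; first by rewrite addr_ge0.
move=> t x t01; have [h|h] := ltP r `|x|; first by rewrite fr// normr0 addr_ge0.
apply: HM; first by rewrite ltr_pwDr// ler_norm.
by exists (t, x) => //; split => //=; rewrite in_itv/= -ler_norml.
Qed.

(** A uniformity in [x] that comes from the compactness of the support in space. *)
Lemma spatially_supported_near f r t0 e : continuous f ->
  spatially_supported r f -> 0 < e ->
  \forall t \near t0, forall x, `|f (t, x) - f (t0, x)| <= e.
Proof.
move=> cf fr e0.
have H x : `[- r, r]%classic x -> \forall x' \near x & t \near t0,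
    `|f (t, x') - f (t0, x')| <= e.
  move=> _; have e2 : 0 < e / 2 by rewrite divr_gt0.
  have /cvgrPdist_le/(_ _ e2)[[A B] /= [nA nB] AB] := cf (t0, x).
  exists (B, A) => //= -[x' t] [/= Bx' At].
  have h1 := AB (t, x') (conj At Bx').
  have h2 := AB (t0, x') (conj (nbhs_singleton nA) Bx').
  rewrite -(subrKA (f (t0, x))) (splitr e) (le_trans (ler_normD _ _))//.
  by rewrite lerD// distrC.
have : near_covering (`[- r, r]%classic : set R).
  by apply/compact_near_coveringP; exact: segment_compact.
move=> /(_ R (nbhs t0) (fun t x => `|f (t, x) - f (t0, x)| <= e) _ H).
apply: filterS => t ht x; have [h|h] := ltP r `|x|.
  by rewrite !fr// subrr normr0 ltW.
by apply: ht; rewrite /= in_itv/= -ler_norml.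
Qed.

End SpatialSupport.

Section Pairing.
Context {R : realType} (n : nat) (S : set 'cV[R]_n).
Local Notation leb := (@lebesgue_measure R).
Implicit Types (mu : R -> mspace S) (f : R * R -> R).

Lemma measurable_mspace (m : mspace S) i : measurable_fun setT (fun x => m x i 0).
Proof. exact: mfun_to_measurable. Qed.

Lemma mspace_in (m : mspace S) x : S (m x).
Proof. exact: mfun_to_in. Qed.

Lemma coord_le_norm (z : 'cV[R]_n) i : `|z i 0| <= `|z|.
Proof.
rewrite [leRHS]/Num.norm/= mx_normrE.
by apply: (le_trans _ (le_bigmax _ _ (i, 0))).
Qed.

Lemma mspace_bounded : compact S ->
  exists K : R, 0 <= K /\ forall (m : mspace S) x i, `|m x i 0| <= K.
Proof.
move=> /compact_bounded[M [_ HM]]; exists (`|M| + 1).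
split; first by rewrite addr_ge0.
move=> m x i; apply: le_trans (coord_le_norm _ _) _.
by apply: HM; [rewrite ltr_pwDr// ler_norm|exact: mspace_in].
Qed.

Lemma continuous_pair_cst (t : R) : continuous (fun x : R => (t, x)).
Proof.
move=> x A [[B C] /= [nB nC] BC]; apply: filterS nC => y Cy.
by apply: BC; split => //; exact: nbhs_singleton nB.
Qed.

Lemma measurable_slice f t : continuous f -> measurable_fun setT (fun x => f (t, x)).
Proof.
move=> cf; apply: continuous_measurable_fun => x.
by apply: (@continuous_comp _ _ _ (fun x => (t, x)) f); [exact: continuous_pair_cst|exact: cf].
Qed.

Hypothesis compactS : compact S.

Lemma integrable_pairing f r t (m : mspace S) i : continuous f ->
  spatially_supported r f -> `[0, 1]%classic t ->
  leb.-integrable setT (EFin \o (fun x => f (t, x) * m x i 0)).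
Proof.
move=> cf fr t01.
have [C [C0 fC]] := spatially_supported_bounded cf fr.
have [K [K0 mK]] := mspace_bounded compactS.
apply: (@integrable_supported _ _ r (C * K)).
- by apply: measurable_funM; [exact: measurable_slice|exact: measurable_mspace].
- by move=> x; rewrite normrM ler_pM// ?fC// mK.
- by move=> x rx; rewrite fr// mul0r.
Qed.

Lemma Cc0_slice f r t i : continuous f -> spatially_supported r f ->
  Cc0 (fun x => f (t, x) *: (delta_mx i 0 : 'cV[R]_n)).
Proof.
move=> cf fr; split.
  move=> x; apply: cvgZr_tmp.
  by apply: (@continuous_comp _ _ _ (fun x => (t, x)) f); [exact: continuous_pair_cst|exact: cf].
apply: (@subclosed_compact _ _ (`[- r, r]%classic : set R)).
- exact: closed_closure.
- exact: segment_compact.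
- apply: closure_sub_closed; first exact: interval_closed.
  move=> x /= h; rewrite in_itv/= -ler_norml leNgt; apply/negP => rx.
  by move: h; rewrite fr// scale0r eqxx.
Qed.

Lemma dotcv_delta (z : 'cV[R]_n) c i : dotcv z (c *: delta_mx i 0) = c * z i 0.
Proof.
rewrite /dotcv -scalemxAr mxE; congr (_ * _).
rewrite mxE (bigD1 i)//= big1 => [|j ji]; rewrite !mxE ?eqxx ?mulr1 ?addr0//.
by rewrite (negbTE ji) mulr0.
Qed.

(** Weak-star continuity handles the slice of [f] frozen at time [t0]; the error
    made by freezing it is small uniformly in [x] while the values of the curve
    stay in the bounded set [S]. *)
Lemma pairing_continuous f r mu i : continuous f -> spatially_supported r f ->
  weakly_star_continuous 1 mu ->
  {within `[0, 1], continuous (fun t => \int[leb]_x (f (t, x) * mu t x i 0))}.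
Proof.
move=> cf fr wmu; apply/subspace_continuousP => t0 t001; apply/cvgrPdist_le => e e0.
have /subspace_continuousP/(_ t0 t001)/cvgrPdist_le := wmu _ (Cc0_slice t0 i cf fr).
move=> /(_ (e / 2) (divr_gt0 e0 (ltr0n _ 2))).
have [K [K0 mK]] := mspace_bounded compactS.
pose L := fine (leb (`[- r, r]%classic : set R)).
have L0 : 0 <= L by rewrite fine_ge0.
(* L is the length of an interval containing the support in space, and K
   bounds the curve. *)
pose d := e / 2 / (K * L + 1).
have KL0 : 0 < K * L + 1 by rewrite ltr_wpDl// mulr_ge0.
have d0 : 0 < d by rewrite !divr_gt0.
have := spatially_supported_near t0 cf fr d0.
rewrite !near_withinE => H1 H2; near=> t => t01.
have A1 : forall x, `|f (t, x) - f (t0, x)| <= d by near: t.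
have : `[0, 1]%classic t -> `|\int[leb]_x dotcv (mu t0 x) (f (t0, x) *: delta_mx i 0) -
   \int[leb]_x dotcv (mu t x) (f (t0, x) *: delta_mx i 0)| <= e / 2 by near: t.
move=> /(_ t01) A2.
have E u : \int[leb]_x dotcv (mu u x) (f (t0, x) *: delta_mx i 0) =
    \int[leb]_x (f (t0, x) * mu u x i 0).
  by apply: eq_Rintegral => x _; exact: dotcv_delta.
rewrite !E in A2.
have iI s u : `[0, 1]%classic s ->
    leb.-integrable setT (EFin \o (fun x => f (s, x) * mu u x i 0)).
  exact: (@integrable_pairing f r s (mu u)).
have H3 : `|\int[leb]_x (f (t0, x) * mu t x i 0) - \int[leb]_x (f (t, x) * mu t x i 0)| <= e / 2.
  rewrite -RintegralB//; try exact: iI.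
  under eq_Rintegral do rewrite -mulrBl.
  apply: le_trans (@Rintegral_supported_le _ _ r (d * K) _ _ _) _.
  - apply: measurable_funM; last exact: measurable_mspace.
    by apply: measurable_funB; exact: measurable_slice.
  - by move=> x; rewrite normrM ler_pM// distrC.
  - by move=> x rx; rewrite !fr// subrr mul0r.
  - have e2 : 0 < e / 2 by rewrite divr_gt0.
    by rewrite -mulrA -/L /d mulrAC ler_pdivrMr// ler_pM2l// lerDl.
rewrite (splitr e) -(subrKA (\int[leb]_x (f (t0, x) * mu t x i 0))).
by rewrite (le_trans (ler_normD _ _))// lerD.
Unshelve. all: by end_near. Qed.

End Pairing.

(** * Flux through a function of time and space *)
Section Flux.
Context {R : realType} (n : nat).
Local Notation leb := (@lebesgue_measure R).
Implicit Types (w : R -> R -> 'cV[R]_n) (f : R * R -> R).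

Definition unit_strip : set (R * R) := `[0, 1]%classic `*` setT.

Lemma measurable_unit_strip : measurable unit_strip.
Proof. by apply: measurableX => //; exact: measurable_itv. Qed.

(** Extended by 0 outside the strip, so that Fubini's theorem applies on the whole
    plane. *)
Definition strip_flux f w i : R * R -> R :=
  (fun z => f z * w z.1 z.2 i 0) \_ unit_strip.

Lemma strip_flux_in f w i t x : `[0, 1]%classic t ->
  strip_flux f w i (t, x) = f (t, x) * w t x i 0.
Proof. by move=> t01; rewrite /strip_flux patchE mem_set. Qed.

Lemma strip_flux_out f w i t x : ~ `[0, 1]%classic t ->
  strip_flux f w i (t, x) = 0.
Proof. by move=> t01; rewrite /strip_flux patchE memNset// => -[]. Qed.

Lemma measurable_strip_flux f w i : continuous f -> measurable_family 1 w ->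
  measurable_fun setT (strip_flux f w i).
Proof.
move=> cf mw; apply: (measurable_restrictT (fun z => f z * w z.1 z.2 i 0) measurable_unit_strip).1.
apply: measurable_funM; last exact: mw.
apply: measurable_funTS; exact: continuous_measurable_plane.
Qed.

Lemma integrable_strip_flux f r w i : continuous f -> spatially_supported r f ->
  measurable_family 1 w -> locally_integrable_family 1 w ->
  (leb \x leb)%E.-integrable setT (EFin \o strip_flux f w i).
Proof.
move=> cf fr mw lw.
have mF := measurable_strip_flux i cf mw.
have [C [C0 fC]] := spatially_supported_bounded cf fr.
apply/integrable12ltyP; first exact/measurable_EFinP.
pose q := Num.max r 1.
have q0 : 0 < q by rewrite lt_max ltr01 orbT.
have mq : measurable (`[- q, q]%classic : set R) by exact: measurable_itv.
have mI : measurable (`[0, 1]%classic : set R) by exact: measurable_itv.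
pose J := (\int[leb]_(t in `[0%R, 1%R]) \int[leb]_(x in `[(- q)%R, q]) (`|w t x|)%:E)%E.
have J0 : (0 <= J)%E by apply: integral_ge0 => t _; exact: integral_ge0.
have CJ : (C%:E * J < +oo)%E.
  have := lw q q0; rewrite -/J; move: J J0 => [j| |]//= _ _.
  by rewrite -EFinM ltry.
apply: le_lt_trans CJ; rewrite -ge0_integralZl_lower//; last first.
  by move=> t _; exact: integral_ge0.
rewrite [leRHS]integral_mkcond; apply: ge0_le_integral_lower => t _.
  exact: integral_ge0.
rewrite patchE; case: ifPn => [/set_mem t01|/negP t01]; last first.
  rewrite integral0_eq// => x _ /=; rewrite strip_flux_out ?normr0//.
  by move=> h; apply: t01; rewrite inE.
rewrite -ge0_integralZl_lower//.
rewrite [leRHS]integral_mkcond; apply: ge0_le_integral_lower => x _; first by [].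
rewrite patchE /= strip_flux_in//; case: ifPn => [_|/negP h].
  rewrite lee_fin normrM ler_pM//; first exact: fC.
  exact: coord_le_norm.
rewrite fr ?mul0r ?normr0//; rewrite ltNge; apply/negP => h'; apply: h.
by rewrite inE/= in_itv/= -ler_norml (le_trans h')// le_max lexx.
Qed.

Definition flux f w i t : R := \int[leb]_x (f (t, x) * w t x i 0).

(** Fubini's theorem gives the integrability of the extended-real inner integral,
    and passing to its finite part only decreases absolute values. *)
Lemma integrable_flux f r w i : continuous f -> spatially_supported r f ->
  measurable_family 1 w -> locally_integrable_family 1 w ->
  leb.-integrable `[0, 1] (EFin \o flux f w i).
Proof.
move=> cf fr mw lw; have iF := integrable_strip_flux i cf fr mw lw.
pose Y t := (\int[leb]_x (strip_flux f w i (t, x))%:E)%E.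
have iY : leb.-integrable `[0, 1] Y.
  by apply: integrableS (integrable_fubini_F iF) => //; exact: measurable_itv.
have mY := measurable_int _ iY.
have E t : `[0, 1]%classic t -> flux f w i t = fine (Y t).
  move=> t01; rewrite /flux /Rintegral /Y; congr fine.
  by apply: eq_integral => x _; rewrite strip_flux_in.
apply: (@eq_integrable _ _ _ leb `[0, 1]%classic _ (EFin \o (fine \o Y))).
- exact: measurable_itv.
- by move=> t /set_mem t01 /=; rewrite E.
apply: (le_integrable _ _ _ iY) => //.
- apply/measurable_EFinP; apply: measurableT_comp mY; exact: fine_measurable.
- by move=> t _ /=; case: (Y t) => [y| |]//=; rewrite normr0 leey.
Qed.

End Flux.

(** * The continuity equation up to the end times *)
Section BoundaryIdentity.
Context {R : realType} (n : nat) (S : set 'cV[R]_n).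
Local Notation leb := (@lebesgue_measure R).
Implicit Types (mu : R -> mspace S) (w : R -> R -> 'cV[R]_n) (f psi : R * R -> R).

Lemma spatially_supported_derive r psi v :
  spatially_supported r psi -> spatially_supported r (fun z => 'D_v psi z).
Proof.
move=> pr t x rx; rewrite (@near_eq_derive _ _ _ _ (cst (0 : R))) ?derive_cst//.
exists (setT, [set x | r < `|x|]) => /=.
  split; first exact: filterT.
  have c : `|y| @[y --> (x : R)] --> `|x : R| by apply: cvg_norm; exact: cvg_id.
  by move/cvgr_gt : c => /(_ r rx).
by case=> t' x' [_ /=]; exact: pr.
Qed.

Lemma derive_fst (eta : R -> R) (v z : R * R) : smooth_on setT eta ->
  'D_v (fun z : R * R => eta z.1) z = v.1 * 'D_1 eta z.1.
Proof.
move=> se; have aL : affine_along (@fst R R) (@fst R R) by [].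
apply: etrans (derive_affine eta z v aL) _.
by rewrite deriveR//; exact: smooth_on_derivable.
Qed.

Lemma smooth_on_fst (eta : R -> R) : smooth_on setT eta ->
  smooth_on setT (fun z : R * R => eta z.1).
Proof.
move=> se; have aL : affine_along (@fst R R) (@fst R R) by [].
by apply: (smooth_on_affine aL) => //; move=> z; exact: cvg_fst.
Qed.

Lemma test_function_cutoff (eta : R -> R) psi r c d :
  smooth_on setT eta -> smooth_on setT psi -> spatially_supported r psi ->
  0 < c -> d < 1 -> (forall t, (t <= c) || (d <= t) -> eta t = 0) ->
  test_function 1 (fun z => eta z.1 * psi z).
Proof.
move=> se sp pr c0 d1 e0.
have supp : closure [set z | eta z.1 * psi z != 0] `<=`
    `[c, d]%classic `*` `[- r, r]%classic.
  apply: closure_sub_closed.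
    apply: closedI; apply: closed_comp; try exact: interval_closed.
      by move=> z _; exact: cvg_fst.
    by move=> z _; exact: cvg_snd.
  move=> [t x] /= h; split; rewrite /= in_itv/=.
    move: h; apply: contraNT; rewrite negb_and -!ltNge => /orP th.
    by rewrite e0 ?mul0r//; case: th => /ltW ->; rewrite ?orbT.
  rewrite -ler_norml leNgt; apply: contra h => rx.
  by rewrite pr// mulr0.
split.
- by apply: smooth_onM => //; exact: smooth_on_fst.
- apply: (@subclosed_compact _ _ (`[c, d]%classic `*` `[- r, r]%classic)).
  + exact: closed_closure.
  + by apply: compact_setX; exact: segment_compact.
  + exact: supp.
- move=> z /supp [/= h _]; split => //=; move: h.
  by rewrite !in_itv/= => /andP[h1 h2]; apply/andP; split; lra.
Qed.

Hypothesis compactS : compact S.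

(** With [a t] the pairing of [psi] and [mu] at time [t], the continuity equation
    tested with [eta z.1 * psi z] says that the weak derivative of [a] is the sum of
    the two inner integrals on the left; the fundamental theorem for weak
    derivatives concludes. *)
Lemma boundary_identity (m0 m1 : mspace S) mu w psi r i :
  curves 1 m0 m1 (mu, w) -> smooth_on setT psi -> spatially_supported r psi ->
  \int[leb]_(t in `[0, 1]) \int[leb]_x ('D_(1, 0) psi (t, x) * mu t x i 0) +
  \int[leb]_(t in `[0, 1]) \int[leb]_x ('D_(0, 1) psi (t, x) * w t x i 0) =
  \int[leb]_x (psi (1, x) * m1 x i 0) - \int[leb]_x (psi (0, x) * m0 x i 0).
Proof.
move=> [/= wmu mw lw ce [mu0 mu1]] sp pr.
have mI : measurable (`[0, 1]%classic : set R) by exact: measurable_itv.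
pose dt := (fun z => 'D_(1, 0) psi z) : R * R -> R.
pose dx := (fun z => 'D_(0, 1) psi z) : R * R -> R.
have cp : continuous psi := smooth_on_continuous sp.
have cdt : continuous dt := smooth_on_continuous (smooth_on_derive ((1, 0) : R * R) sp).
have cdx : continuous dx := smooth_on_continuous (smooth_on_derive ((0, 1) : R * R) sp).
have dtr : spatially_supported r dt by exact: spatially_supported_derive.
have dxr : spatially_supported r dx by exact: spatially_supported_derive.
pose a t := \int[leb]_x (psi (t, x) * mu t x i 0).
pose b t := \int[leb]_x (dt (t, x) * mu t x i 0).
pose g := flux dx w i.
have ca : {within `[0, 1], continuous a} by exact: (pairing_continuous compactS cp pr wmu).
have cb : {within `[0, 1], continuous b} by exact: (pairing_continuous compactS cdt dtr wmu).
have ib := integrable_within_continuous cb.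
have ig : leb.-integrable `[0, 1] (EFin \o g) by exact: (integrable_flux i cdx dxr mw lw).
rewrite -mu0 -mu1 -[RHS]/(a 1 - a 0).
rewrite -[X in X + _]/(\int[leb]_(t in `[0, 1]) b t).
rewrite -[X in _ + X]/(\int[leb]_(t in `[0, 1]) g t).
rewrite -RintegralD//; apply: weak_derivative_increment => //.
  rewrite (_ : EFin \o _ = (EFin \o b) \+ (EFin \o g))%E//.
  exact: integrableD.
move=> eta c d se c0 d1 e0.
have cD1 : continuous (fun t : R => 'D_1 eta t).
  by have := smooth_on_continuous (smooth_on_derive (1 : R) se).
have ce' : continuous eta := smooth_on_continuous se.
have tf := test_function_cutoff se sp pr c0 d1 e0.
have zt t x : 'D_(1, 0) (fun z => eta z.1 * psi z) (t, x) =
    'D_1 eta t * psi (t, x) + eta t * dt (t, x).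
  rewrite (smooth_on_deriveM ((t, x) : R * R) ((1, 0) : R * R) (smooth_on_fst se) sp) derive_fst//=.
  by rewrite mul1r addrC mulrC [in X in _ + X]mulrC mulrC (mulrC (psi _)).
have zx t x : 'D_(0, 1) (fun z => eta z.1 * psi z) (t, x) = eta t * dx (t, x).
  rewrite (smooth_on_deriveM ((t, x) : R * R) ((0, 1) : R * R) (smooth_on_fst se) sp) derive_fst//=.
  by rewrite mul0r mulr0 addr0.
apply: etrans _ (ce _ i tf).
have ieb : leb.-integrable `[0, 1] (EFin \o (fun t => eta t * b t)).
  apply: integrable_within_continuous; apply: within_continuousM => //.
  exact: continuous_subspaceT.
have iea : leb.-integrable `[0, 1] (EFin \o (fun t => 'D_1 eta t * a t)).
  apply: integrable_within_continuous; apply: within_continuousM => //.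
  exact: continuous_subspaceT.
have -> : \int[leb]_(t in `[0, 1]) (eta t * (b t + g t)) =
    \int[leb]_(t in `[0, 1]) (eta t * b t) + \int[leb]_(t in `[0, 1]) (eta t * g t).
  rewrite -RintegralD//; first by apply: eq_Rintegral => t _; rewrite mulrDr.
  have [C [_ HC]] := compact_bounded (continuous_compact
    (continuous_subspaceT ce' : {within `[0, 1], continuous eta}) (@segment_compact R 0 1)).
  have iCg : leb.-integrable `[0, 1] (fun t => ((`|C| + 1)%:E * (`|g t|)%:E))%E.
    by apply: integrableZl => //; exact: integrable_norm.
  apply: (le_integrable _ _ _ iCg) => //.
    apply/measurable_EFinP; apply: measurable_funM; last first.
      by apply/measurable_EFinP; exact: measurable_int ig.
    by apply: measurable_funTS; exact: continuous_measurable_fun.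
  move=> t t01 /=; rewrite lee_fin !normrM normr_id ler_wpM2r//.
  rewrite [leRHS]ger0_norm ?addr_ge0//; apply: HC; last by exists t.
  by rewrite ltr_pwDr// ler_norm.
rewrite addrA; congr (_ + _); last first.
  apply: eq_Rintegral => t _; rewrite -RintegralZl_lower//.
  by apply: eq_Rintegral => x _; rewrite zx mulrA.
rewrite -RintegralD//; apply: eq_Rintegral => t /set_mem t01.
have h1 := integrable_pairing compactS (mu t) i cp pr t01.
have h2 := integrable_pairing compactS (mu t) i cdt dtr t01.
rewrite -!RintegralZl_lower// -RintegralD//.
- by apply: eq_Rintegral => x _; rewrite zt mulrDl !mulrA.
- exact: integrableZl h1.
- exact: integrableZl h2.
Qed.

End BoundaryIdentity.

(** * Density of the interior of a convex set *)
Section ConvexClosure.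
Context {R : realType} (n : nat) (S : set 'cV[R]_n).
Hypothesis convexS : convex_set (S : set (convex_lmodType 'cV[R]_n)).

Lemma convex_combination (x y : 'cV[R]_n) (l : R) : 0 <= l <= 1 -> S x -> S y ->
  S (l *: x + (1 - l) *: y).
Proof.
move=> /andP[l0 l1] Sx Sy.
have := convexS (Itv01 l0 l1) (mem_set Sx) (mem_set Sy).
by rewrite inE.
Qed.

(** The homothety of ratio [l] centred at [y] maps a ball around [x] inside [S] to a
    ball around the new point, inside [S] by convexity. *)
Lemma interior_segment (x y : 'cV[R]_n) (l : R) : 0 < l <= 1 -> interior S x ->
  S y -> interior S (l *: x + (1 - l) *: y).
Proof.
move=> /andP[l0 l1] /nbhs_ballP[e /= e0 eS] Sy.
apply/nbhs_ballP; exists (l * e) => /=; first by rewrite mulr_gt0.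
move=> u hu.
have -> : u = l *: (x + l^-1 *: (u - (l *: x + (1 - l) *: y))) + (1 - l) *: y.
  rewrite scalerDr scalerA divff ?gt_eqF// scale1r.
  by rewrite addrCA opprD (addrA (l *: x)) subrr add0r subrK.
apply: convex_combination => //; first by rewrite (ltW l0) l1.
apply: eS; rewrite -ball_normE /= opprD addNKr normrN normrZ.
rewrite gtr0_norm ?invr_gt0// -ltr_pdivlMl ?invr_gt0// invrK.
by move: hu; rewrite -ball_normE /= distrC.
Qed.

(** A point of [S] is approached along the segment towards an interior point. *)
Lemma convex_closure_interior : interior S !=set0 -> S `<=` closure (interior S).
Proof.
move=> [x ix] y Sy A /nbhs_ballP[e /= e0 eA].
pose l := Num.min 1 (e / (`|x - y| + 1)) / 2.
have d0 : 0 < `|x - y| + 1 by rewrite ltr_wpDl.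
have m0 : 0 < Num.min 1 (e / (`|x - y| + 1)) by rewrite lt_min ltr01 divr_gt0.
have l0 : 0 < l by rewrite divr_gt0.
have l1 : l <= 1.
  by rewrite /l ler_pdivrMr// mul1r (@le_trans _ _ 1)// ?ge_min ?lexx// ler1n.
exists (l *: x + (1 - l) *: y); split.
  by apply: interior_segment; rewrite ?l0.
apply: eA; rewrite -ball_normE /=.
rewrite scalerBl scale1r addrCA -scalerBr opprD addrA subrr sub0r normrN normrZ.
rewrite gtr0_norm// (@le_lt_trans _ _ (l * (`|x - y| + 1)))//.
  by rewrite ler_pM2l// lerDl.
rewrite -ltr_pdivlMr// /l ltr_pdivrMr//.
have : Num.min 1 (e / (`|x - y| + 1)) <= e / (`|x - y| + 1) by rewrite ge_min lexx orbT.
move=> /le_lt_trans; apply; rewrite ltr_pMr ?ltr1n//.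
by rewrite divr_gt0.
Qed.

End ConvexClosure.

(** * Positive definite quadratic forms *)
Section QuadraticForms.
Context {R : realType} (n : nat).
Implicit Types (A : 'M[R]_n) (u v p : 'cV[R]_n).

Definition bilin A u v : R := (u^T *m A *m v) 0 0.

Lemma quadfE A u : quadf A u = bilin A u u. Proof. by []. Qed.

Lemma bilinDl A u u' v : bilin A (u + u') v = bilin A u v + bilin A u' v.
Proof. by rewrite /bilin linearD/= !mulmxDl mxE. Qed.

Lemma bilinDr A u v v' : bilin A u (v + v') = bilin A u v + bilin A u v'.
Proof. by rewrite /bilin mulmxDr mxE. Qed.

Lemma bilinZl A c u v : bilin A (c *: u) v = c * bilin A u v.
Proof. by rewrite /bilin linearZ/= -!scalemxAl mxE. Qed.

Lemma bilinZr A c u v : bilin A u (c *: v) = c * bilin A u v.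
Proof. by rewrite /bilin -!scalemxAr mxE. Qed.

Lemma posdef_ge0 A u : sym_posdef A -> 0 <= quadf A u.
Proof.
move=> [_ pA]; have [->|u0] := eqVneq u 0; last exact/ltW/pA.
by rewrite /quadf mulmx0 mxE.
Qed.

Lemma posdef_unitmx A : sym_posdef A -> A \in unitmx.
Proof.
move=> [_ pA]; rewrite -row_free_unit -kermx_eq0; apply/rowV0P => v /sub_kermxP vA.
apply/eqP; apply: contraT => v0.
have := pA v^T; rewrite -(inj_eq trmx_inj) trmxK trmx0 => /(_ v0).
by rewrite /quadf trmxK vA mul0mx mxE ltxx.
Qed.

Lemma quadf_inv A p : sym_posdef A -> quadf (invmx A) p = quadf A (invmx A *m p).
Proof.
move=> pA; have uA := posdef_unitmx pA; case: pA => sA _.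
rewrite /quadf trmx_mul trmx_inv sA.
by rewrite -[p^T *m _ *m A]mulmxA mulVmx// mulmx1 !mulmxA.
Qed.

(** The Cauchy-Schwarz inequality for the form [A], applied to the basis vector
    [e_i] and [q = A^-1 p]: their product is [p_i], and the squared length of [q]
    is [p^T A^-1 p]. *)
Lemma coord_sq_le A p i : sym_posdef A ->
  p i 0 ^+ 2 <= A i i * quadf (invmx A) p.
Proof.
move=> pA; rewrite quadf_inv//; set q := invmx A *m p.
have uA := posdef_unitmx pA.
have pE : p = A *m q by rewrite mulmxA mulmxV// mul1mx.
set e := delta_mx i 0 : 'cV[R]_n.
have Aii : A i i = quadf A e.
  by rewrite /quadf trmx_delta -rowE -colE !mxE.
have Aeq : bilin A e q = p i 0.
  by rewrite /bilin trmx_delta -mulmxA -pE -rowE mxE.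
have Aqe : bilin A q e = p i 0.
  rewrite -Aeq /bilin -[RHS]trace_mx11 -mxtrace_tr.
  by rewrite !trmx_mul trmxK (proj1 pA) mulmxA trace_mx11.
have Aii0 : 0 < A i i.
  rewrite Aii; apply: (proj2 pA); apply/eqP => /matrixP/(_ i 0).
  by rewrite !mxE !eqxx => /eqP; rewrite oner_eq0.
(* The form at q minus its A-projection onto e. *)
have := posdef_ge0 (q + (- (p i 0 / A i i)) *: e) pA.
rewrite quadfE bilinDl !bilinDr !bilinZl !bilinZr -!quadfE -Aii Aeq Aqe.
set c := p i 0 / A i i.
have cE : p i 0 = c * A i i by rewrite /c divfK// gt_eqF.
rewrite cE => h.
have : 0 <= A i i * (quadf A q + - c * (c * A i i) + (- c * (c * A i i) + - c * (- c * A i i))).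
  by rewrite mulr_ge0// ltW.
nra.
Qed.

End QuadraticForms.

(** * The action density *)
Section ActionDensity.
Context {R : realType} (n : nat) (S : set 'cV[R]_n) (M : 'cV[R]_n -> 'M[R]_n).
Hypothesis posM : forall z, interior S z -> sym_posdef (M z).
Local Open Scope ereal_scope.

Let F (z p : 'cV[R]_n) : set_system ('cV[R]_n * 'cV[R]_n) :=
  within (interior S `*` setT) (nbhs (z, p)).

(** The lower limit is a supremum over neighbourhoods of infima, so one
    neighbourhood bounds it from below, and a bound on it from above must hold
    for all of them. *)
Lemma phi_lower z p (V : set ('cV[R]_n * 'cV[R]_n)) (y : \bar R) : F z p V ->
  (forall zp, V zp -> y <= (phi_tilde M zp.1 zp.2)%:E) -> y <= phi S M z p.
Proof.
move=> FV Vy; rewrite /phi limf_einfE.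
apply: (@le_trans _ _ (ereal_inf [set (phi_tilde M zp.1 zp.2)%:E | zp in V])).
  by apply: le_ereal_inf_tmp => _ [zp Vzp <-]; exact: Vy.
by apply: ereal_sup_ubound; exists V.
Qed.

Lemma phi_upper z p (y : \bar R) :
  (forall V, F z p V -> ereal_inf [set (phi_tilde M zp.1 zp.2)%:E | zp in V] <= y) ->
  phi S M z p <= y.
Proof.
move=> Vy; rewrite /phi limf_einfE; apply: ge_ereal_sup => _ [V FV <-].
exact: Vy.
Qed.

Lemma within_domain z p : F z p (interior S `*` setT).
Proof. exact: withinT. Qed.

Lemma phi_ge0 z p : 0 <= phi S M z p.
Proof.
apply: (phi_lower (within_domain z p)) => -[z' p'] [/= iz _].
by rewrite lee_fin /phi_tilde quadf_inv; [apply: posdef_ge0|]; exact: posM.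
Qed.

(** The density is 2-homogeneous in [p], and scaling [p] is continuous, so it acts
    on the neighbourhoods that define the envelope. *)
Lemma phi_scale_le z p (c : R) : (c != 0)%R ->
  phi S M z (c *: p) <= (c ^+ 2)%:E * phi S M z p.
Proof.
move=> c0; have c2 : (0 < c ^+ 2)%R by rewrite exprn_even_gt0.
apply: phi_upper => V FV; rewrite -lee_pdivrMl//.
have FV' : F z p [set zp | V (zp.1, c *: zp.2)].
  pose g := fun zp : 'cV[R]_n * 'cV[R]_n => (zp.1, c *: zp.2).
  have [[A B] /= [nA nB] AB] := FV.
  have nB' : nbhs p [set p' | B (c *: p')] by exact: (@scaler_continuous R _ c p).
  exists (A, [set p' | B (c *: p')]) => // -[z' p'] [/= Az' Bp'] [/= iz _].
  exact: (AB (z', c *: p')).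
apply: (phi_lower FV') => -[z' p'] /= Vzp; rewrite lee_pdivrMl//.
apply: ereal_inf_lbound; exists (z', c *: p') => //=.
rewrite -EFinM; congr EFin; rewrite /phi_tilde !quadfE bilinZl bilinZr.
by rewrite mulrA.
Qed.

(** Interior points [z'] near [z], paired with zero flux, give the value 0 in every
    neighbourhood. *)
Lemma phi_zero z : closure (interior S) z -> phi S M z 0 = 0.
Proof.
move=> clz; apply/eqP; rewrite eq_le phi_ge0 andbT.
apply: phi_upper => V [[A B] /= [nA nB] AB].
have [z' [iz' Az']] := clz _ nA.
apply: ereal_inf_lbound; exists (z', 0%R) => /=.
  by apply: (AB (z', 0%R)) => //; split => //=; exact: nbhs_singleton nB.
by rewrite /phi_tilde /quadf mulmx0 mxE.
Qed.

(** The diagonal entries of [M] are bounded on the compact set [S], which makes the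
    Cauchy-Schwarz bound uniform; it passes to the envelope since [p_i] is
    continuous in [p]. *)
Lemma phi_coercive : compact S -> {within S, continuous M} ->
  exists c : R, (0 < c)%R /\ forall z (p : 'cV[R]_n) i, S z ->
    ((c * p i 0 ^+ 2)%R)%:E <= phi S M z p.
Proof.
move=> cS cM.
have [K [K0 MK]] : exists K : R, (0 < K)%R /\ forall z i, S z -> (M z i i <= K)%R.
  have [B [_ HB]] := compact_bounded (continuous_compact cM cS).
  exists (`|B| + 1)%R; split; first by rewrite ltr_wpDl.
  move=> z i Sz; apply: le_trans (ler_norm _) _.
  apply: (@le_trans _ _ `|M z|%R).
    rewrite [leRHS]/Num.norm/= mx_normrE.
    by apply: (le_trans _ (le_bigmax _ _ (i, i))).
  by apply: HB; [rewrite ltr_pwDr// ler_norm|exists z].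
exists K^-1%R; split; first by rewrite invr_gt0.
move=> z p i Sz; apply/lee_subgt0Pr => e e0.
have FV : F z p [set zp : 'cV[R]_n * 'cV[R]_n | (interior S zp.1) /\
    (K^-1 * p i 0 ^+ 2 - e < K^-1 * zp.2 i 0 ^+ 2)%R].
  have c1 : (fun p' : 'cV[R]_n => p' i 0%R) p' @[p' --> p] --> p i 0%R.
    exact: coord_continuous.
  have c2 : (fun p' : 'cV[R]_n => K^-1 * p' i 0 ^+ 2)%R p' @[p' --> p] -->
      (K^-1 * p i 0 ^+ 2)%R.
    have h : continuous (fun x : R => K^-1 * x ^+ 2)%R.
      by move=> x; apply: cvgMl_tmp; exact: exprn_continuous.
    exact: (cvg_comp _ _ c1 (h _)).
  have : (K^-1 * p i 0 ^+ 2 - e < K^-1 * p i 0 ^+ 2)%R by rewrite ltrBlDr ltrDl.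
  move/cvgr_gt : c2 => /[apply] c3.
  exists (setT, [set p' : 'cV[R]_n | (K^-1 * p i 0 ^+ 2 - e < K^-1 * p' i 0 ^+ 2)%R]) => /=.
    by split => //; exact: filterT.
  by case=> z' p' /= [_ h] [].
apply: (phi_lower FV) => -[z' p'] /= [iz h].
rewrite -EFinB lee_fin; apply: le_trans (ltW h) _.
rewrite ler_pdivrMl//; apply: le_trans (coord_sq_le p' i (posM iz)) _.
rewrite /phi_tilde ler_wpM2r//.
  by rewrite quadf_inv; [apply: posdef_ge0|]; exact: posM.
apply: MK; exact: interior_subset iz.
Qed.

End ActionDensity.

(** * Gluing functions of time *)
Section Reparametrization.
Context {R : realType}.
Local Notation leb := (@lebesgue_measure R).
Implicit Types (a F : R -> R).

Lemma within_affine (A : set R) a (c d : R) : {within `[0, 1], continuous a} ->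
  (forall t, A t -> `[0, 1]%classic (c * t + d)) ->
  {within A, continuous (fun t => a (c * t + d))}.
Proof.
move=> /subspace_continuousP ca AI; apply/subspace_continuousP => t At.
apply: (@cvg_comp _ _ _ (fun t : R => c * t + d) a _ (within `[0, 1] (nbhs (c * t + d)))).
  move=> B /= wB.
  have {}wB : \forall s \near (c * t + d : R), (`[0, 1]%classic : set R) s -> B s by [].
  move/(continuous_affineR (c:=c) (b:=d)) : wB => /=; rewrite !near_simpl.
  by apply: filterS => s h As; apply: h; exact: AI.
by apply: ca; exact: AI.
Qed.

Lemma measurable_fun_affine (A : set R) F (c d : R) : measurable A ->
  measurable_fun (`[0, 1]%classic : set R) F ->
  (forall t, A t -> `[0, 1]%classic (c * t + d)) ->
  measurable_fun A (fun t => F (c * t + d)).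
Proof.
move=> mA mF AI.
apply: (@measurable_comp _ _ _ _ _ _ (`[0, 1]%classic : set R) F A (affine c d)) => //.
- by move=> _ [t At <-]; exact: AI.
- by apply: measurable_funTS; exact: measurable_affine.
Qed.

Lemma measurable_plane_affine (A : set R) (F : R * R -> R) (c d : R) : measurable A ->
  measurable_fun (@unit_strip R) F ->
  (forall t, A t -> `[0, 1]%classic (c * t + d)) ->
  measurable_fun (A `*` [set: R]) (fun z : R * R => F (c * z.1 + d, z.2)).
Proof.
move=> mA mF AI.
apply: (@measurable_comp _ _ _ _ _ _ (@unit_strip R) F
  (A `*` [set: R]) (fun z : R * R => (affine c d z.1, z.2))) => //.
- exact: measurable_unit_strip.
- by move=> _ [z [Az _] <-]; split => //=; exact: AI.
- apply: measurable_funTS; apply: measurable_fun_pair.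
    by apply: measurableT_comp => //; exact: measurable_affine.
  exact: measurable_snd.
Qed.

Definition glue (X : Type) (s : R) (F1 F2 : R -> X) (t : R) : X :=
  if t <= s then F1 (t / s) else F2 ((t - s) / (1 - s)).

Section Glue.
Variable s : R.
Hypothesis s01 : 0 < s < 1.

Let s0 : 0 < s. Proof. by case/andP: s01. Qed.
Let s1 : 0 < 1 - s. Proof. by case/andP: s01; rewrite subr_gt0. Qed.

Lemma glue_left X (F1 F2 : R -> X) t : t <= s -> glue s F1 F2 t = F1 (t / s).
Proof. by rewrite /glue => ->. Qed.

Lemma glue_right X (F1 F2 : R -> X) t : F1 1 = F2 0 -> s <= t ->
  glue s F1 F2 t = F2 ((t - s) / (1 - s)).
Proof.
move=> F12; rewrite le_eqVlt /glue => /predU1P[<-|st].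
  by rewrite lexx divff ?gt_eqF// subrr mul0r.
by rewrite leNgt st.
Qed.

Lemma left_reparam t : `[0, s]%classic t -> `[0, 1]%classic (s^-1 * t + 0).
Proof.
rewrite /= !in_itv/= => /andP[t0 ts]; rewrite addr0 mulr_ge0 ?invr_ge0 ?(ltW s0)//=.
by rewrite ler_pdivrMl// mulr1.
Qed.

Lemma right_reparam t : `[s, 1]%classic t ->
  `[0, 1]%classic ((1 - s)^-1 * t + - (s / (1 - s))).
Proof.
rewrite /= !in_itv/= => /andP[ts t1].
rewrite [X in _ + X](_ : _ = (1 - s)^-1 * - s); last by rewrite mulrN mulrC.
rewrite -mulrDr mulr_ge0 ?invr_ge0 ?(ltW s1) ?subr_ge0//=.
by rewrite ler_pdivrMl// mulr1 lerB.
Qed.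

Lemma left_reparamE t : t / s = s^-1 * t + 0.
Proof. by rewrite addr0 mulrC. Qed.

Lemma right_reparamE t : (t - s) / (1 - s) = (1 - s)^-1 * t + - (s / (1 - s)).
Proof. by rewrite mulrBl mulrC. Qed.

Lemma glue_within F1 F2 : {within `[0, 1], continuous F1} ->
  {within `[0, 1], continuous F2} -> F1 1 = F2 0 ->
  {within `[0, 1], continuous (glue s F1 F2)}.
Proof.
move=> cF1 cF2 F12.
have -> : `[0, 1]%classic = `[0, s]%classic `|` `[s, 1]%classic :> set R.
  apply/seteqP; split => t /=; rewrite !in_itv/=.
    by move=> /andP[t0 t1]; have [h|h] := leP t s; [left|right];
      apply/andP; split => //; rewrite ltW.
  by case: s01 => /andP[? ?] [] /andP[? ?]; apply/andP; split; lra.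
apply: withinU_continuous; try exact: interval_closed.
  apply: (subspace_eq_continuous (f := fun t => F1 (s^-1 * t + 0))).
    by move=> t /set_mem /=; rewrite in_itv/= => /andP[_ ts];
      rewrite /from_subspace/= glue_left// left_reparamE.
  by apply: within_affine => //; exact: left_reparam.
apply: (subspace_eq_continuous (f := fun t => F2 ((1 - s)^-1 * t + - (s / (1 - s))))).
  by move=> t /set_mem /=; rewrite in_itv/= => /andP[ts _];
    rewrite /from_subspace/= glue_right// right_reparamE.
by apply: within_affine => //; exact: right_reparam.
Qed.

Lemma unit_interval_split : `[0, 1]%classic = `[0, s]%classic `|` `]s, 1]%classic :> set R.
Proof.
case/andP: s01 => p0 p1; apply/seteqP; split => t /=; rewrite !in_itv/=.
  by move=> /andP[t0 t1]; have [h|h] := leP t s; [left|right]; apply/andP.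
by case=> /andP[? ?]; apply/andP; split; lra.
Qed.

Lemma disjoint_split : [disjoint (`[0, s]%classic : set R) & `]s, 1]%classic].
Proof.
apply/disj_setPS => t /= []; rewrite !in_itv/= => /andP[_ ts] /andP[st _].
by move: st; rewrite ltNge ts.
Qed.

(** A measurable minorant of the glued function restricts to measurable minorants
    of the two rescaled pieces. *)
Lemma ge0_integral_glue (F1 F2 : R -> \bar R) :
  (forall t, 0 <= F1 t)%E -> (forall t, 0 <= F2 t)%E ->
  (\int[leb]_(t in `[0%R, 1%R]) glue s F1 F2 t <=
   s%:E * (\int[leb]_(t in `[0%R, 1%R]) F1 t) +
   (1 - s)%:E * (\int[leb]_(t in `[0%R, 1%R]) F2 t))%E.
Proof.
move=> F10 F20; apply: integral_le_minorants.
- exact: measurable_itv.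
- by move=> t _; rewrite /glue; case: ifP.
move=> h mh h0 hF; rewrite {1}unit_interval_split.
rewrite ge0_integral_setU//; last 2 first.
- exact: measurable_funTS.
- exact: disjoint_split.
apply: leeD.
  have E := integral_unit_affine 0 F1 s0; rewrite add0r in E.
  apply: le_trans (_ : _ <= \int[leb]_(t in `[0%R, s]) F1 ((t - 0) / s)%R)%E _;
    last by rewrite E; exact: lexx.
  apply: ge0_le_integral_lower => // t ts; rewrite subr0.
  have := ts; rewrite /= in_itv/= => /andP[_ ts'].
  rewrite -(glue_left F1 F2 ts'); apply: hF; rewrite unit_interval_split; by left.
have E := integral_unit_affine s F2 s1; rewrite subrKC in E.
apply: le_trans (_ : _ <= \int[leb]_(t in `[s, 1%R]) F2 ((t - s) / (1 - s))%R)%E _;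
  last by rewrite E; exact: lexx.
rewrite [leLHS]integral_mkcond [leRHS]integral_mkcond.
apply: ge0_le_integral_lower => t _; first by rewrite patchE; case: ifP.
rewrite !patchE; case: ifPn => [/set_mem ts|_]; last by case: ifP.
have := ts; rewrite /= in_itv/= => /andP[st t1].
rewrite ifT; last by rewrite inE/= in_itv/= (ltW st).
have := hF t; rewrite /glue (leNgt t s) st; apply; rewrite unit_interval_split; by right.
Qed.

Lemma measurable_glue (F1 F2 : R -> R) :
  measurable_fun (`[0, 1]%classic : set R) F1 ->
  measurable_fun (`[0, 1]%classic : set R) F2 ->
  measurable_fun (`[0, 1]%classic : set R) (glue s F1 F2).
Proof.
move=> mF1 mF2; rewrite unit_interval_split.
apply/measurable_funU; try exact: measurable_itv; split.
  apply: (eq_measurable_fun (fun t => F1 (s^-1 * t + 0))).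
    move=> t /set_mem /=; rewrite in_itv/= => /andP[_ ts].
    by rewrite glue_left// left_reparamE.
  apply: measurable_fun_affine => //.
  exact: left_reparam.
apply: (eq_measurable_fun (fun t => F2 ((1 - s)^-1 * t + - (s / (1 - s))))).
  move=> t /set_mem /=; rewrite in_itv/= => /andP[st _].
  by rewrite /glue leNgt st right_reparamE.
apply: measurable_fun_affine => //.
move=> t ts; apply: right_reparam; move: ts; rewrite /= !in_itv/= => /andP[h ->].
by rewrite (ltW h).
Qed.

Lemma integrable_glue (F1 F2 : R -> R) :
  leb.-integrable `[0, 1] (EFin \o F1) -> leb.-integrable `[0, 1] (EFin \o F2) ->
  leb.-integrable `[0, 1] (EFin \o glue s F1 F2).
Proof.
move=> i1 i2; apply/integrableP; split.
  apply/measurable_EFinP; apply: measurable_glue; apply/measurable_EFinP.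
    exact: measurable_int i1.
  exact: measurable_int i2.
have -> : (\int[leb]_(t in `[0%R, 1%R]) `|(EFin \o glue s F1 F2) t| =
    \int[leb]_(t in `[0%R, 1%R])
      glue s (fun t => `|(EFin \o F1) t|) (fun t => `|(EFin \o F2) t|) t)%E.
  by apply: eq_integral => t _; rewrite /glue /=; case: ifP.
apply: le_lt_trans (ge0_integral_glue _ _) _ => //.
move/integrableP : i1 => [_]; move/integrableP : i2 => [_].
have p1 : (0 <= \int[leb]_(t in `[0%R, 1%R]) `|(EFin \o F1) t|)%E by exact: integral_ge0.
have p2 : (0 <= \int[leb]_(t in `[0%R, 1%R]) `|(EFin \o F2) t|)%E by exact: integral_ge0.
move: p1 p2.
move: (integral _ _ _) (integral _ _ _) => [x| |] [y| |]//= _ _ _ _.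
by rewrite -!EFinM -EFinD ltry.
Qed.

Lemma Rintegral_glue (F1 F2 : R -> R) :
  leb.-integrable `[0, 1] (EFin \o F1) -> leb.-integrable `[0, 1] (EFin \o F2) ->
  \int[leb]_(t in `[0, 1]) glue s F1 F2 t =
  s * (\int[leb]_(t in `[0, 1]) F1 t) + (1 - s) * (\int[leb]_(t in `[0, 1]) F2 t).
Proof.
move=> i1 i2; have ig := integrable_glue i1 i2.
rewrite {1}unit_interval_split Rintegral_setU; last 4 first.
- exact: measurable_itv.
- exact: measurable_itv.
- by rewrite -unit_interval_split.
- exact: disjoint_split.
have i2' : leb.-integrable `]s, 1] (EFin \o (fun t => F2 ((t - s) / (1 - s)))).
  apply: (@eq_integrable _ _ _ leb `]s, 1]%classic _ (EFin \o glue s F1 F2)).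
  - exact: measurable_itv.
  - move=> t /set_mem /=; rewrite in_itv/= => /andP[st _].
    by rewrite /glue leNgt st.
  - apply: integrableS ig; try exact: measurable_itv.
    by rewrite unit_interval_split; exact: subsetUr.
congr (_ + _).
  have := Rintegral_unit_affine 0 F1 s0; rewrite add0r => <-.
  apply: eq_Rintegral => t /set_mem /=; rewrite in_itv/= => /andP[_ ts].
  by rewrite glue_left// subr0.
have := Rintegral_unit_affine s F2 s1; rewrite subrKC => <-.
rewrite -Rintegral_itv_obnd_cbnd//.
apply: eq_Rintegral => t /set_mem /=; rewrite in_itv/= => /andP[st _].
by rewrite /glue leNgt st.
Qed.

(** The factors [s^-1] and [(1 - s)^-1] are those that the chain rule puts on time
    derivatives and on fluxes when the two curves are accelerated. *)
Lemma Rintegral_glue_scaled (F1 F2 : R -> R) :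
  leb.-integrable `[0, 1] (EFin \o F1) -> leb.-integrable `[0, 1] (EFin \o F2) ->
  \int[leb]_(t in `[0, 1])
    glue s (fun t => s^-1 * F1 t) (fun t => (1 - s)^-1 * F2 t) t =
  \int[leb]_(t in `[0, 1]) F1 t + \int[leb]_(t in `[0, 1]) F2 t.
Proof.
have mI : measurable (`[0, 1]%classic : set R) by exact: measurable_itv.
move=> i1 i2; rewrite Rintegral_glue; last 2 first.
- by apply: (integrableZl _ s^-1 i1).
- by apply: (integrableZl _ (1 - s)^-1 i2).
by rewrite !RintegralZl_lower// !mulrA !divff ?mul1r// gt_eqF.
Qed.

End Glue.
End Reparametrization.

(** * Test functions under a change of time *)
Section TestFunctions.
Context {R : realType}.
Implicit Types (psi : R * R -> R).

Lemma derive_slice_time psi t x :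
  'D_1 (fun s : R => psi (s, x)) t = 'D_(1, 0) psi (t, x).
Proof.
have aL : affine_along (fun s : R => (s, x)) (fun s : R => (s, 0 : R)).
  by move=> y v h; congr pair; rewrite /= ?scaler0 ?add0r.
exact: (derive_affine psi t 1 aL).
Qed.

Lemma derive_slice_space psi t x :
  'D_1 (fun y : R => psi (t, y)) x = 'D_(0, 1) psi (t, x).
Proof.
have aL : affine_along (fun y : R => (t, y)) (fun y : R => (0 : R, y)).
  by move=> y v h; congr pair; rewrite /= ?scaler0 ?add0r.
exact: (derive_affine psi x 1 aL).
Qed.

Lemma continuous_pair_cst_time (x : R) : continuous (fun t : R => (t, x)).
Proof.
move=> t A [[B C] /= [nB nC] BC]; apply: filterS nB => y By.
by apply: BC; split => //; exact: nbhs_singleton nC.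
Qed.

Lemma smooth_slice_time psi x : smooth_on setT psi ->
  smooth_on setT (fun s : R => psi (s, x)).
Proof.
apply: (@smooth_on_affine _ _ _ psi (fun s : R => (s, x)) (fun s : R => (s, 0 : R))).
  by move=> y v h; congr pair; rewrite /= ?scaler0 ?add0r.
exact: continuous_pair_cst_time.
Qed.

Definition reparam psi (c d : R) (z : R * R) : R := psi (c * z.1 + d, z.2).

Lemma continuous_affine_time (c d : R) :
  continuous (fun z : R * R => (c * z.1 + d, z.2)).
Proof.
move=> [t x] A [[B C] /= [nB nC] BC].
have nB' : nbhs t [set s | B (c * s + d)] by exact: (@continuous_affineR R c d t _ nB).
exists ([set s | B (c * s + d)], C) => // -[t' x'] [/= Bt Cx].
exact: (BC (c * t' + d, x') (conj Bt Cx)).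
Qed.

Lemma smooth_reparam psi c d : smooth_on setT psi -> smooth_on setT (reparam psi c d).
Proof.
apply: (@smooth_on_affine R _ _ psi (fun z : R * R => (c * z.1 + d, z.2))
  (fun z : R * R => (c * z.1, z.2))).
  by move=> y v h; congr pair; rewrite /= -![_ *: _]/(_ * _); ring.
exact: continuous_affine_time.
Qed.

Lemma derive_reparam_time psi c d t x : smooth_on setT psi ->
  'D_(1, 0) (reparam psi c d) (t, x) = c * 'D_(1, 0) psi (c * t + d, x).
Proof.
move=> sp; rewrite -derive_slice_time -derive_slice_time.
exact: (derive_affineR c d t (smooth_slice_time x sp)).
Qed.

Lemma derive_reparam_space psi c d t x :
  'D_(0, 1) (reparam psi c d) (t, x) = 'D_(0, 1) psi (c * t + d, x).
Proof. by rewrite -derive_slice_space -derive_slice_space. Qed.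

Lemma spatially_supported_reparam r psi c d : spatially_supported r psi ->
  spatially_supported r (reparam psi c d).
Proof. by move=> pr t x rx; rewrite /reparam pr. Qed.

(** The two facts about supports that the boundary identity needs: a bounded range
    of [x], and zero boundary terms. *)
Lemma test_function_support (T : R) psi : test_function T psi ->
  (exists r, spatially_supported r psi) /\
  (forall t x, ~ `]0, T[%classic t -> psi (t, x) = 0).
Proof.
move=> [_ cK sK]; split.
  have cS : compact (snd @` closure [set z | psi z != 0]).
    by apply: continuous_compact => //; apply: continuous_subspaceT => z; exact: cvg_snd.
  have [B [_ HB]] := compact_bounded cS; exists (`|B| + 1) => t x rx.
  apply: contraTeq rx => p0; rewrite -leNgt; apply: HB.
    by rewrite ltr_pwDr// ler_norm.
  by exists (t, x) => //; exact: subset_closure.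
move=> t x nt; apply: contra_notP nt => /eqP p0.
have : closure [set z | psi z != 0] (t, x) by exact: subset_closure.
by move=> /sK[].
Qed.

End TestFunctions.

(** * Reversed, glued and constant curves *)
Section CurveOperations.
Context {R : realType} (n : nat) (S : set 'cV[R]_n).
Hypothesis compactS : compact S.
Local Notation leb := (@lebesgue_measure R).
Implicit Types (mu : R -> mspace S) (w : R -> R -> 'cV[R]_n).

Lemma Rintegral0 d (T : measurableType d) (m : {measure set T -> \bar R}) (D : set T) :
  \int[m]_(x in D) (0 : R) = 0.
Proof. by rewrite /Rintegral integral0. Qed.

(** Test the original curve with the time-reversed test function: the time
    derivative changes sign, which the sign of the flux matches. *)
Lemma curves_reverse (m0 m1 : mspace S) mu w : curves 1 m0 m1 (mu, w) ->
  curves 1 m1 m0 (fun t => mu (1 - t), fun t x => - w (1 - t) x).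
Proof.
move=> cmw; have [/= wmu mw lw ce [mu0 mu1]] := cmw; split => /=.
- move=> rho crho; exact: (within_unit_reverse (wmu _ crho)).
- move=> i.
  have := @measurable_plane_affine R `[0, 1]%classic (fun z => w z.1 z.2 i 0) (-1) 1
    (measurable_itv _) (mw i).
  have I01 t : `[0, 1]%classic t -> `[0, 1]%classic (-1 * t + 1 : R).
    by rewrite /= !in_itv/= => /andP[? ?]; apply/andP; split; lra.
  move=> /(_ I01) h.
  rewrite (_ : (fun _ => _) = (fun z : R * R => - w (-1 * z.1 + 1) z.2 i 0)).
    exact: measurable_funN.
  by apply/funext => z; rewrite mxE mulN1r addrC.
- move=> r r0; have := lw r r0; rewrite -integral_unit_reverse.
  apply: le_lt_trans; apply: ge0_le_integral_lower => t _; first exact: integral_ge0.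
  by apply: ge0_le_integral_lower => x _ //; rewrite normrN.
- move=> psi i tp; have [[r pr] p0] := test_function_support tp.
  have sp : smooth_on setT psi by case: tp.
  pose psi' := reparam psi (-1) 1.
  have sp' : smooth_on setT psi' by exact: smooth_reparam.
  have := boundary_identity compactS i cmw sp' (spatially_supported_reparam (-1) 1 pr).
  have z01 t x : t = 0 \/ t = 1 -> psi (t, x) = 0.
    by move=> h; apply: p0 => /=; rewrite in_itv/= => /andP[? ?]; case: h; lra.
  have E0 (m : mspace S) t : t = 0 \/ t = 1 ->
      \int[leb]_x (psi' (t, x) * m x i 0) = 0.
    move=> h; rewrite -[RHS](Rintegral0 leb setT); apply: eq_Rintegral => x _.
    by rewrite /psi' /reparam /= z01 ?mul0r//; case: h => ->; [right|left]; lra.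
  rewrite !E0; [|by left|by right]; rewrite subrr => E.
  have E1 : \int[leb]_(t in `[0, 1]) \int[leb]_x ('D_(1, 0) psi (t, x) * mu (1 - t) x i 0) =
      - \int[leb]_(t in `[0, 1]) \int[leb]_x ('D_(1, 0) psi' (t, x) * mu t x i 0).
    rewrite -Rintegral_unit_reverse -RintegralN_lower; apply: eq_Rintegral => t _.
    rewrite -RintegralN_lower; apply: eq_Rintegral => x _.
    by rewrite derive_reparam_time// mulN1r mulNr opprK subKr mulN1r (addrC _ 1).
  have E2 : \int[leb]_(t in `[0, 1]) \int[leb]_x ('D_(0, 1) psi (t, x) * (- w (1 - t) x) i 0) =
      - \int[leb]_(t in `[0, 1]) \int[leb]_x ('D_(0, 1) psi' (t, x) * w t x i 0).
    rewrite -Rintegral_unit_reverse -RintegralN_lower; apply: eq_Rintegral => t _.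
    rewrite -RintegralN_lower; apply: eq_Rintegral => x _.
    by rewrite derive_reparam_space// mxE mulrN subKr mulN1r (addrC _ 1).
  by rewrite /= E1 E2 -opprD E oppr0.
- by rewrite subr0 subrr.
Qed.

Lemma measurable_family_glue s w1 w2 : 0 < s < 1 ->
  measurable_family 1 w1 -> measurable_family 1 w2 ->
  measurable_family 1 (glue s (fun t x => s^-1 *: w1 t x)
                              (fun t x => (1 - s)^-1 *: w2 t x)).
Proof.
move=> s01 m1 m2 i.
have -> : `[0, 1]%classic `*` [set: R] =
    (`[0, s]%classic `*` [set: R]) `|` (`]s, 1]%classic `*` [set: R]) :> set (R * R).
  rewrite (unit_interval_split s01); apply/seteqP; split => [z [[h|h] _]|z [[h _]|[h _]]].
  - by left.
  - by right.
  - by split => //; left.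
  - by split => //; right.
apply/measurable_funU; try by apply: measurableX => //; exact: measurable_itv.
split.
  apply: (@eq_measurable_fun _ _ _ _ _
    (fun z : R * R => s^-1 * w1 (s^-1 * z.1 + 0) z.2 i 0)).
    move=> z /set_mem [/= ]; rewrite in_itv/= => /andP[_ zs] _.
    by rewrite glue_left// mxE left_reparamE.
  apply: (@measurable_plane_affine R `[0, s]%classic
    (fun z => s^-1 * w1 z.1 z.2 i 0) s^-1 0).
  - exact: measurable_itv.
  - by apply: measurable_funM; [exact: measurable_cst|exact: m1].
  - exact: left_reparam.
apply: (@eq_measurable_fun _ _ _ _ _
  (fun z : R * R => (1 - s)^-1 * w2 ((1 - s)^-1 * z.1 + - (s / (1 - s))) z.2 i 0)).
  move=> z /set_mem [/= ]; rewrite in_itv/= => /andP[sz _] _.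
  by rewrite /glue (leNgt z.1) sz mxE right_reparamE.
apply: (@measurable_plane_affine R `]s, 1]%classic
  (fun z => (1 - s)^-1 * w2 z.1 z.2 i 0) (1 - s)^-1 (- (s / (1 - s)))).
- exact: measurable_itv.
- by apply: measurable_funM; [exact: measurable_cst|exact: m2].
- move=> t ts; apply: right_reparam => //; move: ts; rewrite /= !in_itv/= => /andP[h ->].
  by rewrite (ltW h).
Qed.

Lemma integral_norm_scale (c r : R) w : 0 <= c ->
  (\int[leb]_(t in `[0%R, 1%R]) \int[leb]_(x in `[(- r)%R, r]) (`|c *: w t x|)%:E =
   c%:E * \int[leb]_(t in `[0%R, 1%R]) \int[leb]_(x in `[(- r)%R, r]) (`|w t x|)%:E)%E.
Proof.
move=> c0; rewrite -ge0_integralZl_lower//; last first.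
  by move=> t _; exact: integral_ge0.
apply: eq_integral => t _; rewrite -ge0_integralZl_lower//.
by apply: eq_integral => x _; rewrite normrZ ger0_norm// EFinM.
Qed.

Lemma locally_integrable_glue s w1 w2 : 0 < s < 1 ->
  locally_integrable_family 1 w1 -> locally_integrable_family 1 w2 ->
  locally_integrable_family 1 (glue s (fun t x => s^-1 *: w1 t x)
                              (fun t x => (1 - s)^-1 *: w2 t x)).
Proof.
move=> s01 l1 l2 r r0; have [s0 s1] : 0 < s /\ 0 < 1 - s.
  by case/andP: s01 => ? ?; rewrite subr_gt0.
pose J w t := (\int[leb]_(x in `[(- r)%R, r]) (`|w t x : 'cV[R]_n|)%:E)%E.
have J0 w t : (0 <= J w t)%E by exact: integral_ge0.
have fin (c d : R) w : 0 <= c -> 0 <= d -> locally_integrable_family 1 w ->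
    (d%:E * \int[leb]_(t in `[0%R, 1%R]) J (fun t x => c *: w t x) t < +oo)%E.
  move=> c0 d0 lw; rewrite /J integral_norm_scale// muleA.
  apply: lte_mul_pinfty => //; last exact: lw.
  by rewrite mule_ge0// lee_fin.
rewrite (_ : (\int[leb]_(t in `[0%R, 1%R]) _)%E =
    (\int[leb]_(t in `[0%R, 1%R])
      glue s (J (fun t x => s^-1 *: w1 t x))
        (J (fun t x => (1 - s)^-1 *: w2 t x)) t)%E); last first.
  by apply: eq_integral => t _; rewrite /glue /J; case: ifP.
apply: le_lt_trans (ge0_integral_glue s01 (J0 _) (J0 _)) _.
apply: lte_add_pinfty; apply: fin => //; rewrite ?invr_ge0 ltW//.
Qed.

(** Each half of the glued curve, brought back to unit time, is tested with the
    corresponding half of [psi], which does not vanish at the junction: the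
    boundary identity leaves the pairing of [psi (s, x)] with [m1], with opposite
    signs in the two halves. *)
Lemma continuity_equation_glue s m0 m1 m2 mu1 w1 mu2 w2 : 0 < s < 1 ->
  curves 1 m0 m1 (mu1, w1) -> curves 1 m1 m2 (mu2, w2) ->
  continuity_equation 1 (glue s mu1 mu2) (glue s (fun t x => s^-1 *: w1 t x)
                              (fun t x => (1 - s)^-1 *: w2 t x)).
Proof.
move=> s01 c1 c2 psi i tp; have [[r pr] p0] := test_function_support tp.
have z01 t x : t = 0 \/ t = 1 -> psi (t, x) = 0.
  by move=> h; apply: p0 => /=; rewrite in_itv/= => /andP[? ?]; case: h; lra.
have [s0 s1] : 0 < s /\ 0 < 1 - s.
  by case/andP: s01 => ? ?; rewrite subr_gt0.
have sp : smooth_on setT psi by case: tp.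
pose psi1 := reparam psi s 0; pose psi2 := reparam psi (1 - s) s.
have sp1 : smooth_on setT psi1 by exact: smooth_reparam.
have sp2 : smooth_on setT psi2 by exact: smooth_reparam.
have pr1 := spatially_supported_reparam s 0 pr.
have pr2 := spatially_supported_reparam (1 - s) s pr.
have B1 := boundary_identity compactS i c1 sp1 pr1.
have B2 := boundary_identity compactS i c2 sp2 pr2.
have [/= wmu1 mw1 lw1 _ _] := c1; have [/= wmu2 mw2 lw2 _ _] := c2.
pose D (v : R * R) (p : R * R -> R) : R * R -> R := fun z => 'D_v p z.
have cD v p : smooth_on setT p -> continuous (D v p).
  by move=> h; exact: (smooth_on_continuous (smooth_on_derive v h)).
have pD v p : spatially_supported r p -> spatially_supported r (D v p).
  exact: spatially_supported_derive.
pose b mu p t := \int[leb]_x (D (1, 0) p (t, x) * (mu : R -> mspace S) t x i 0).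
pose g w p t := flux (D (0, 1) p) w i t.
have ib mu p : weakly_star_continuous 1 mu -> smooth_on setT p ->
    spatially_supported r p -> leb.-integrable `[0, 1] (EFin \o b mu p).
  move=> wmu h hr; apply: integrable_within_continuous.
  exact: (pairing_continuous compactS (cD _ _ h) (pD _ _ hr) wmu).
have ig w p : measurable_family 1 w -> locally_integrable_family 1 w ->
    smooth_on setT p -> spatially_supported r p ->
    leb.-integrable `[0, 1] (EFin \o g w p).
  by move=> mw lw h hr; exact: (integrable_flux i (cD _ _ h) (pD _ _ hr) mw lw).
have sK t : s * (t / s) + 0 = t by rewrite addr0 mulrC divfK// gt_eqF.
have sK' t : (1 - s) * ((t - s) / (1 - s)) + s = t.
  by rewrite mulrC divfK ?subrK// gt_eqF.
have Eb : \int[leb]_(t in `[0, 1]) \int[leb]_x ('D_(1, 0) psi (t, x) * glue s mu1 mu2 t x i 0) =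
    \int[leb]_(t in `[0, 1]) b mu1 psi1 t + \int[leb]_(t in `[0, 1]) b mu2 psi2 t.
  transitivity (\int[leb]_(t in `[0, 1]) glue s (fun t => s^-1 * b mu1 psi1 t)
      (fun t => (1 - s)^-1 * b mu2 psi2 t) t).
    apply: eq_Rintegral => t _; rewrite /glue /b; case: ifP => _;
      rewrite -RintegralZl_lower//; apply: eq_Rintegral => x _;
      rewrite /D derive_reparam_time// ?sK ?sK' !mulrA mulVf ?mul1r// gt_eqF//.
  by apply: (Rintegral_glue_scaled s01); exact: ib.
have Eg : \int[leb]_(t in `[0, 1]) \int[leb]_x ('D_(0, 1) psi (t, x) *
      glue s (fun t x => s^-1 *: w1 t x) (fun t x => (1 - s)^-1 *: w2 t x) t x i 0) =
    \int[leb]_(t in `[0, 1]) g w1 psi1 t + \int[leb]_(t in `[0, 1]) g w2 psi2 t.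
  transitivity (\int[leb]_(t in `[0, 1]) glue s (fun t => s^-1 * g w1 psi1 t)
      (fun t => (1 - s)^-1 * g w2 psi2 t) t).
    apply: eq_Rintegral => t _; rewrite /glue /g /flux; case: ifP => _;
      rewrite -RintegralZl_lower//; apply: eq_Rintegral => x _;
      rewrite mxE mulrCA /D derive_reparam_space// ?sK ?sK'//.
  by apply: (Rintegral_glue_scaled s01); exact: ig.
have trace (m : mspace S) (f h : R -> R) : f =1 h ->
    \int[leb]_x (f x * m x i 0) = \int[leb]_x (h x * m x i 0).
  by move=> fh; apply: eq_Rintegral => x _; rewrite fh.
have trace0 (m : mspace S) (f : R -> R) : (forall x, f x = 0) ->
    \int[leb]_x (f x * m x i 0) = 0.
  move=> f0; rewrite -[RHS](Rintegral0 leb setT); apply: eq_Rintegral => x _.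
  by rewrite f0 mul0r.
pose mid := \int[leb]_x (psi (s, x) * m1 x i 0).
have R1 : \int[leb]_x (psi1 (1, x) * m1 x i 0) - \int[leb]_x (psi1 (0, x) * m0 x i 0) = mid - 0.
  congr (_ - _).
    by apply: trace => x; rewrite /psi1 /reparam/= mulr1 addr0.
  by apply: trace0 => x; rewrite /psi1 /reparam/= z01//; left; rewrite mulr0 addr0.
have R2 : \int[leb]_x (psi2 (1, x) * m2 x i 0) - \int[leb]_x (psi2 (0, x) * m1 x i 0) = 0 - mid.
  congr (_ - _).
    by apply: trace0 => x; rewrite /psi2 /reparam/= z01//; right; rewrite mulr1 subrK.
  by apply: trace => x; rewrite /psi2 /reparam/= mulr0 add0r.
rewrite Eb Eg addrACA.
apply: etrans (congr2 +%R (etrans B1 R1) (etrans B2 R2)) _.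
by rewrite subr0 sub0r subrr.
Qed.

Lemma curves_glue s m0 m1 m2 mu1 w1 mu2 w2 : 0 < s < 1 ->
  curves 1 m0 m1 (mu1, w1) -> curves 1 m1 m2 (mu2, w2) ->
  curves 1 m0 m2 (glue s mu1 mu2, glue s (fun t x => s^-1 *: w1 t x)
                              (fun t x => (1 - s)^-1 *: w2 t x)).
Proof.
move=> s01 c1 c2; have ce := continuity_equation_glue s01 c1 c2.
have [s0 s1] : 0 < s /\ 0 < 1 - s.
  by case/andP: s01 => ? ?; rewrite subr_gt0.
have [/= wmu1 mw1 lw1 _ [a0 a1]] := c1; have [/= wmu2 mw2 lw2 _ [b0 b1]] := c2.
split => /=.
- move=> rho crho; have h1 := wmu1 _ crho; have h2 := wmu2 _ crho.
  rewrite (_ : (fun t => _) = glue s (fun t => \int[leb]_x dotcv (mu1 t x) (rho x))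
      (fun t => \int[leb]_x dotcv (mu2 t x) (rho x))).
    by apply: glue_within => //; rewrite a1 b0.
  by apply/funext => t; rewrite /glue; case: ifP.
- exact: measurable_family_glue.
- exact: locally_integrable_glue.
- exact: ce.
- rewrite glue_left ?(ltW s0)// mul0r a0; split => //.
  rewrite glue_right ?a1 ?b0//; first by rewrite divff ?b1// gt_eqF.
  by rewrite -subr_ge0 ltW.
Qed.

(** By Fubini's theorem, for each [x] the time derivative of the test function
    integrates to 0. *)
Lemma curves_cst (m : mspace S) : curves 1 m m (fun=> m, fun _ _ => 0).
Proof.
have mI : measurable (`[0, 1]%classic : set R) by exact: measurable_itv.
split => /=.
- by move=> rho _; apply: continuous_subspaceT => t; exact: cst_continuous.
- by move=> i; rewrite (_ : (fun _ => _) = cst 0) //; apply/funext => z; rewrite mxE.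
- move=> r r0; rewrite (_ : (\int[leb]_(t in `[0%R, 1%R]) _)%E = 0%E) ?ltry//.
  apply: integral0_eq => t _; apply: integral0_eq => x _.
  by rewrite normr0.
- move=> psi i tp; have [[r pr] p0] := test_function_support tp.
  have sp : smooth_on setT psi by case: tp.
  have z01 t x : t = 0 \/ t = 1 -> psi (t, x) = 0.
    by move=> h; apply: p0 => /=; rewrite in_itv/= => /andP[? ?]; case: h; lra.
  rewrite [X in _ + X](_ : _ = 0) ?addr0; last first.
    rewrite -[RHS](Rintegral0 leb `[0, 1]%classic); apply: eq_Rintegral => t _.
    rewrite -[RHS](Rintegral0 leb setT); apply: eq_Rintegral => x _.
    by rewrite mxE mulr0.
  pose dt := (fun z => 'D_(1, 0) psi z) : R * R -> R.
  have cdt : continuous dt.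
    exact: (smooth_on_continuous (smooth_on_derive ((1, 0) : R * R) sp)).
  have dtr : spatially_supported r dt by exact: spatially_supported_derive.
  (* The constant density m is put in place of a flux, so that the
     integrability proved for fluxes licenses Fubini's theorem. *)
  pose w (t x : R) := m x.
  have mw : measurable_family 1 w.
    move=> j; apply: measurable_funTS.
    by apply: (measurableT_comp (measurable_mspace m j)); exact: measurable_snd.
  have lw : locally_integrable_family 1 w.
    move=> q q0; have [B [_ HB]] := compact_bounded compactS.
    apply: (@le_lt_trans _ _ (\int[leb]_(t in `[0%R, 1%R])
        \int[leb]_(x in `[(- q)%R, q]) (`|B| + 1)%:E)%E).
      apply: ge0_le_integral_lower => t _; first exact: integral_ge0.
      apply: ge0_le_integral_lower => x _ //.
      rewrite lee_fin; apply: HB; last exact: mspace_in.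
      by rewrite ltr_pwDr// ler_norm.
    have fin (a b c : R) : (\int[leb]_(x in `[a, b]) c%:E)%E \is a fin_num.
      apply: integrable_fin_num => //; apply: integrable_within_continuous.
      by apply: continuous_subspaceT => x; exact: cst_continuous.
    by rewrite -(fineK (fin (- q) q _)) ltey_eq fin.
  have iF := integrable_strip_flux i cdt dtr mw lw.
  have inner t : `[0, 1]%classic t ->
      ((\int[leb]_x ('D_(1, 0) psi (t, x) * m x i 0))%:E =
      \int[leb]_x (strip_flux dt w i (t, x))%:E)%E.
    move=> t01; have ip := integrable_pairing compactS m i cdt dtr t01.
    rewrite /Rintegral fineK; last exact: integrable_fin_num.
    by apply: eq_integral => x _; rewrite strip_flux_in.
  rewrite /Rintegral; rewrite (_ : (\int[leb]_(t in _) _)%E = 0%E)//.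
  transitivity (\int[leb]_t \int[leb]_x (strip_flux dt w i (t, x))%:E)%E.
    rewrite [LHS]integral_mkcond; apply: eq_integral => t _.
    rewrite patchE; case: ifPn => [/set_mem|/negP] t01; first exact: inner.
    rewrite integral0_eq// => x _; rewrite strip_flux_out// => h.
    by apply: t01; rewrite inE.
  rewrite (Fubini iF); apply: integral0_eq => x _.
  transitivity (\int[leb]_(t in `[0%R, 1%R]) (dt (t, x) * m x i 0)%:E)%E.
    rewrite [RHS]integral_mkcond; apply: eq_integral => t _ /=.
    rewrite patchE; case: ifPn => [/set_mem|/negP] t01; first by rewrite strip_flux_in.
    by rewrite strip_flux_out// => h; apply: t01; rewrite inE.
  have sx := smooth_slice_time x sp.
  have ct : {within `[0, 1], continuous (fun t => dt (t, x))}.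
    apply: continuous_subspaceT => t.
    apply: (@continuous_comp _ _ _ (fun t : R => (t, x)) dt); last exact: cdt.
    exact: continuous_pair_cst_time.
  have E : \int[leb]_(t in `[0, 1]) (dt (t, x) * m x i 0) = 0.
    under eq_Rintegral do rewrite mulrC.
    rewrite RintegralZl_lower//.
    have -> : \int[leb]_(t in `[0, 1]) dt (t, x) = psi (1, x) - psi (0, x).
      rewrite -(Rintegral_derive ltr01 sx); apply: eq_Rintegral => t _.
      by rewrite derive_slice_time.
    by rewrite !z01 ?subrr ?mulr0//; [left|right].
  rewrite -[LHS]fineK; first exact: (congr1 EFin E).
  apply: integrable_fin_num => //; apply: integrable_within_continuous.
  by apply: within_continuousM => //; apply: continuous_subspaceT => t; exact: cst_continuous.
- by [].
Qed.

End CurveOperations.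

(** * One-sided additivity of lower integrals *)
Section LowerBounds.
Context d (T : measurableType d) (R : realType).
Variable mu : {measure set T -> \bar R}.
Local Open Scope ereal_scope.

(** Both the positive and the negative part are below the absolute value, and the
    absolute difference of two nonnegative numbers is at most their maximum. *)
Lemma abse_integral_le_lower D (f : T -> \bar R) :
  `|\int[mu]_(x in D) f x| <= \int[mu]_(x in D) `|f x|.
Proof.
rewrite integralE.
have p0 : 0 <= \int[mu]_(x in D) f^\+ x by exact: integral_ge0.
have n0 : 0 <= \int[mu]_(x in D) f^\- x by exact: integral_ge0.
have ple : \int[mu]_(x in D) f^\+ x <= \int[mu]_(x in D) `|f x|.
  apply: ge0_le_integral_lower => x _ //.
  by rewrite -[X in _ <= X]/((abse \o f) x) fune_abse leeDl.
have nle : \int[mu]_(x in D) f^\- x <= \int[mu]_(x in D) `|f x|.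
  apply: ge0_le_integral_lower => x _ //.
  by rewrite -[X in _ <= X]/((abse \o f) x) fune_abse leeDr.
move: p0 n0 ple nle.
move: (\int[mu]_(x in D) f^\+ x) (\int[mu]_(x in D) f^\- x)
  (\int[mu]_(x in D) `|f x|) => x y z.
case: x => [x| |]//; case: y => [y| |]//; case: z => [z| |]//=; rewrite ?lee_fin ?leey//.
move=> x0 y0 xz yz; rewrite ler_norml; apply/andP; split; lra.
Qed.

(** A minorant [h] of [k + f] splits as at most [k] plus the positive part of
    [h - k]; the latter is a minorant of [f], measurable because [k] is. *)
Lemma integralD_lower_le D (k : T -> R) (f : T -> \bar R) : measurable D ->
  measurable_fun setT k -> (forall x, (0 <= k x)%R) -> (forall x, D x -> 0 <= f x) ->
  \int[mu]_(x in D) ((k x)%:E + f x) <=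
  \int[mu]_(x in D) (k x)%:E + \int[mu]_(x in D) f x.
Proof.
move=> mD mk k0 f0; apply: integral_le_minorants => //.
  by move=> x Dx; rewrite adde_ge0 ?lee_fin ?f0.
move=> h mh h0 hf.
pose g x := maxe (h x - (k x)%:E) 0.
have mEk : measurable_fun setT (EFin \o k) by exact/measurable_EFinP.
have mg : measurable_fun [set: T] g.
  apply: measurable_maxe; last exact: measurable_cst.
  exact: (emeasurable_funB mh mEk).
have g0 x : 0 <= g x by rewrite le_max lexx orbT.
apply: (@le_trans _ _ (\int[mu]_(x in D) ((k x)%:E + g x))).
  apply: ge0_le_integral_lower => // x Dx.
  rewrite /g; have [hk|hk] := leP (h x) (k x)%:E.
    by rewrite (le_trans hk)// leeDl//; exact: g0.
  apply: (@le_trans _ _ ((k x)%:E + (h x - (k x)%:E))); last first.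
    by rewrite leeD2l// le_max lexx.
  by rewrite addeC subeK.
rewrite ge0_integralD//; last 3 first.
- by move=> x _; rewrite lee_fin.
- exact: measurable_funTS.
- exact: measurable_funTS.
rewrite leeD2l//; apply: ge0_le_integral_lower => // x Dx.
rewrite /g ge_max f0// andbT leeBlDr//; rewrite addeC; exact: hf.
Qed.

End LowerBounds.

(** * The action of reversed, glued and constant curves *)
Section Action.
Context {R : realType} (n : nat) (S : set 'cV[R]_n) (M : 'cV[R]_n -> 'M[R]_n).
Hypothesis posM : forall z, interior S z -> sym_posdef (M z).
Local Notation leb := (@lebesgue_measure R).
Implicit Types (mu : R -> mspace S) (w : R -> R -> 'cV[R]_n).
Local Open Scope ereal_scope.

Lemma action_ge0 mu w : 0 <= action M mu w.
Proof.
by apply: integral_ge0 => t _; apply: integral_ge0 => x _; exact: phi_ge0.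
Qed.

(** An inequality suffices: where equality is wanted, it follows by scaling
    back. *)
Lemma action_scale mu w (c : R) : (c != 0)%R ->
  action M mu (fun t x => c *: w t x) <= (c ^+ 2)%:E * action M mu w.
Proof.
move=> c0; rewrite -ge0_integralZl_lower//; last 2 first.
- by move=> t _; apply: integral_ge0 => x _; exact: phi_ge0.
- exact: sqr_ge0.
apply: ge0_le_integral_lower => t _.
  by apply: integral_ge0 => x _; exact: phi_ge0.
rewrite -ge0_integralZl_lower//; last 2 first.
- by move=> x _; exact: phi_ge0.
- exact: sqr_ge0.
apply: ge0_le_integral_lower => x _; first exact: phi_ge0.
exact: phi_scale_le.
Qed.

Lemma action_reverse mu w :
  action M (fun t => mu (1 - t)%R) (fun t x => - w (1 - t)%R x)%R <= action M mu w.
Proof.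
rewrite [leRHS](_ : _ = action M (fun t => mu (1 - t)%R) (fun t x => w (1 - t)%R x)); last first.
  by rewrite /action -[LHS]integral_unit_reverse.
have := @action_scale (fun t => mu (1 - t)%R) (fun t x => w (1 - t)%R x) (-1)%R.
rewrite oppr_eq0 oner_eq0 sqrrN expr1n mul1e => /(_ isT).
apply: le_trans; rewrite le_eqVlt; apply/orP; left; apply/eqP.
by apply: eq_integral => t _; apply: eq_integral => x _; rewrite scaleN1r.
Qed.

(** Accelerating a curve by the factor [s^-1] multiplies the density by [s^-2] and
    the duration by [s]. *)
Lemma action_glue (s : R) mu1 w1 mu2 w2 : (0 < s < 1)%R ->
  action M (glue s mu1 mu2) (glue s (fun t x => s^-1 *: w1 t x)
                              (fun t x => (1 - s)^-1 *: w2 t x)) <=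
  (s^-1)%:E * action M mu1 w1 + ((1 - s)^-1)%:E * action M mu2 w2.
Proof.
move=> s01; have [s0 s1] : (0 < s /\ 0 < 1 - s)%R.
  by case/andP: s01 => ? ?; rewrite subr_gt0.
pose A mu w t := \int[leb]_x phi S M ((mu : R -> mspace S) t x) ((w : R -> R -> 'cV[R]_n) t x).
have A0 mu w t : 0 <= A mu w t by apply: integral_ge0 => x _; exact: phi_ge0.
rewrite [leLHS](_ : _ = \int[leb]_(t in `[0%R, 1%R])
   glue s (A mu1 (fun t x => s^-1 *: w1 t x))
     (A mu2 (fun t x => (1 - s)^-1 *: w2 t x)) t); last first.
  by apply: eq_integral => t _; rewrite /glue /A; case: ifP.
apply: le_trans (ge0_integral_glue s01 (A0 _ _) (A0 _ _)) _.
have sc (c : R) mu w : (0 < c)%R ->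
    c%:E * action M mu (fun t x => c^-1 *: w t x) <= (c^-1)%:E * action M mu w.
  move=> c0; rewrite -lee_pdivlMl// muleA -EFinM.
  rewrite (_ : (c^-1 * c^-1)%R = (c^-1 ^+ 2)%R) ?expr2//.
  by apply: action_scale; rewrite invr_eq0 gt_eqF.
by apply: leeD; exact: sc.
Qed.

Lemma action_cst (m : mspace S) : (forall z, S z -> closure (interior S) z) ->
  action M (fun=> m) (fun _ _ => 0%R) = 0.
Proof.
move=> clS; apply: integral0_eq => t _; apply: integral0_eq => x _.
by apply: (phi_zero posM); apply: clS; exact: mspace_in.
Qed.

End Action.

(** * Definiteness *)
Section Increment.
Context {R : realType} (n : nat) (S : set 'cV[R]_n) (M : 'cV[R]_n -> 'M[R]_n).
Hypothesis posM : forall z, interior S z -> sym_posdef (M z).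
Local Notation leb := (@lebesgue_measure R).
Implicit Types (mu : R -> mspace S) (w : R -> R -> 'cV[R]_n).

(** Young's inequality in the form [|w| <= lam + w ^ 2 / lam], where the coercivity of
    [phi] bounds [w ^ 2] by [phi / c].  The constant term is a measurable
    function, which is what the one-sided additivity of lower integrals asks
    for. *)
Lemma flux_action_bound (c C r lam : R) f mu w i :
  (forall z (p : 'cV[R]_n) i, S z -> ((c * p i 0 ^+ 2)%:E <= phi S M z p)%E) ->
  0 < c -> 0 < lam -> 0 <= C -> spatially_supported r f ->
  (forall t x, `[0, 1]%classic t -> `|f (t, x)| <= C) ->
  ((`|\int[leb]_(t in `[0, 1]) flux f w i t|)%:E <=
   (C * lam * fine (leb `[- r, r]%classic))%:E +
   (C / (lam * c))%:E * action M mu w)%E.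
Proof.
move=> coer c0 lam0 C0 fr fC.
have mI : measurable (`[0, 1]%classic : set R) by exact: measurable_itv.
have mr : measurable (`[- r, r]%classic : set R) by exact: measurable_itv.
pose k x : R := C * lam * \1_(`[- r, r]%classic) x.
pose L := fine (leb (`[- r, r]%classic : set R)).
have L0 : 0 <= L by apply: fine_ge0.
have Cl0 : 0 <= C * lam by rewrite mulr_ge0// ltW.
have k0 x : 0 <= k x by rewrite /k mulr_ge0// indicE ler0n.
have mk : measurable_fun [set: R] k.
  by apply: measurable_funM; [exact: measurable_cst|apply: measurable_indic].
have phi0 z p : (0 <= phi S M z p)%E by exact: phi_ge0.
have fine_abse (y : \bar R) : ((`|fine y|)%:E <= `|y|)%E.
  by case: y => [y| |]//=; rewrite normr0 leey.
have ck0 : 0 <= C / (lam * c) by rewrite divr_ge0// mulr_ge0 ?ltW.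
have fl t : `[0, 1]%classic t -> ((`|flux f w i t|)%:E <=
    (C * lam * L)%:E + (C / (lam * c))%:E * \int[leb]_x phi S M (mu t x) (w t x))%E.
  move=> t01; apply: le_trans (fine_abse _) _.
  apply: le_trans (abse_integral_le_lower _ _ _) _.
  apply: (@le_trans _ _ (\int[leb]_x ((k x)%:E +
      (C / (lam * c))%:E * phi S M (mu t x) (w t x)))%E).
    apply: ge0_le_integral_lower => x _ //.
    have [rx|xr] := ltP r `|x|.
      by rewrite /= fr// mul0r normr0 adde_ge0 ?lee_fin// mule_ge0 ?lee_fin ?phi0.
    apply: (@le_trans _ _ ((k x)%:E + (C / (lam * c))%:E * (c * w t x i 0 ^+ 2)%:E)%E); last first.
      rewrite leeD2l// lee_wpmul2l ?lee_fin//; apply: coer; exact: mspace_in.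
    rewrite /= -EFinM -EFinD lee_fin /k indicE mem_set/= ?in_itv/= -?ler_norml// mulr1.
    rewrite normrM (_ : C / _ * _ = C * (`|w t x i 0| ^+ 2 / lam)); last first.
      by rewrite -normrX ger0_norm ?sqr_ge0//; field; rewrite !gt_eqF.
    rewrite -mulrDr; apply: ler_pM => //; first exact: fC.
    have : 0 <= `|w t x i 0| by []; move: (`|w t x i 0|) => a a0.
    have [h|h] := leP a lam; first by rewrite ler_wpDr// divr_ge0 ?sqr_ge0 ?ltW.
    apply: (@le_trans _ _ (a ^+ 2 / lam)); last by rewrite lerDr ltW.
    by rewrite ler_pdivlMr// expr2 ler_wpM2l// ltW.
  apply: le_trans (integralD_lower_le leb measurableT mk k0 _) _ => //.
    by move=> x _; rewrite mule_ge0 ?lee_fin ?phi0.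
  rewrite ge0_integralZl_lower// leeD2r//.
  rewrite /k; under eq_integral do rewrite EFinM.
  rewrite ge0_integralZl_lower// integral_indic// setIT.
  rewrite [leRHS]EFinM; apply: lee_wpmul2l; first by rewrite lee_fin.
  rewrite /L fineK// ge0_fin_numE//.
  by apply: compact_finite_measure; exact: segment_compact.
apply: le_trans (fine_abse _) _.
apply: le_trans (abse_integral_le_lower _ _ _) _.
apply: (@le_trans _ _ (\int[leb]_(t in `[0%R, 1%R]) ((C * lam * L)%:E +
    (C / (lam * c))%:E * \int[leb]_x phi S M (mu t x) (w t x)))%E).
  by apply: ge0_le_integral_lower => t t01 //; exact: fl.
have in0 t : (0 <= \int[leb]_x phi S M (mu t x) (w t x))%E.
  by apply: integral_ge0 => x _; exact: phi0.
apply: le_trans (integralD_lower_le leb (k := cst (C * lam * L)) mI _ _ _) _ => //.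
- by move=> t; rewrite mulr_ge0.
- by move=> t _; rewrite mule_ge0// lee_fin.
rewrite ge0_integralZl_lower// leeD2r//.
rewrite (integral_cst leb mI (C * lam * L)%:E) -/L -[leRHS]mule1.
apply: lee_wpmul2l; first by rewrite lee_fin mulr_ge0.
have L1 : leb (`[0, 1]%classic : set R) = 1%E.
  by rewrite lebesgue_measure_itv/= lte_fin ltr01 oppr0 adde0.
by rewrite le_eqVlt; apply/orP; left; apply/eqP; exact: L1.
Qed.

Hypothesis compactS : compact S.

Lemma smooth_on_snd (rho : R -> R) : smooth_on setT rho ->
  smooth_on setT (fun z : R * R => rho z.2).
Proof.
move=> se; have aL : affine_along (@snd R R) (@snd R R) by [].
by apply: (smooth_on_affine aL) => //; move=> z; exact: cvg_snd.
Qed.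

Lemma derive_snd (rho : R -> R) (v z : R * R) : smooth_on setT rho ->
  'D_v (fun z : R * R => rho z.2) z = v.2 * 'D_1 rho z.2.
Proof.
move=> se; have aL : affine_along (@snd R R) (@snd R R) by [].
apply: etrans (derive_affine rho z v aL) _.
by rewrite deriveR//; exact: smooth_on_derivable.
Qed.

(** The boundary identity for a function of [x] alone has no time derivative: the
    increment of the pairing is the flux integral.  Along a curve of action below
    [lam ^ 2] the preceding bound is of order [lam]. *)
Lemma zero_distance_pairing (m0 m1 : mspace S) (rho : R -> R) r i :
  {within S, continuous M} ->
  (forall e : R, 0 < e -> exists2 c, curves 1 m0 m1 c &
     (action M c.1 c.2 < e%:E)%E) ->
  smooth_on setT rho -> (forall x, r < `|x| -> rho x = 0) ->
  \int[leb]_x (rho x * m1 x i 0) = \int[leb]_x (rho x * m0 x i 0).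
Proof.
move=> cM small srho rr.
have [c [c0 coer]] := phi_coercive posM compactS cM.
pose psi (z : R * R) := rho z.2.
have sp : smooth_on setT psi by exact: smooth_on_snd.
have pr : spatially_supported r psi by move=> t x; exact: rr.
pose dx := (fun z => 'D_(0, 1) psi z) : R * R -> R.
have cdx : continuous dx.
  exact: (smooth_on_continuous (smooth_on_derive ((0, 1) : R * R) sp)).
have dxr : spatially_supported r dx by exact: spatially_supported_derive.
have [C [C0 dxC]] := spatially_supported_bounded cdx dxr.
pose L := fine (leb (`[- r, r]%classic : set R)).
pose K := C * L + C / c.
apply/eqP; rewrite -subr_eq0 -normr_le0; apply/ler_addgt0Pr => e e0; rewrite add0r.
have K0 : 0 <= K.
  by rewrite addr_ge0 ?divr_ge0 ?(ltW c0)// mulr_ge0// /L; apply: fine_ge0.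
have K1 : 0 < K + 1 by rewrite ltr_wpDl.
(* K * lam < e, with K + 1 in place of K as K may be 0. *)
pose lam := e / (K + 1); have lam0 : 0 < lam by rewrite divr_gt0.
have [[mu w] /= cmw act] := small (lam ^+ 2) (exprn_gt0 2 lam0).
have := boundary_identity compactS i cmw sp pr.
rewrite [X in X + _ = _](_ : _ = 0) ?add0r; last first.
  rewrite -[RHS](Rintegral0 leb `[0, 1]%classic); apply: eq_Rintegral => t _.
  rewrite -[RHS](Rintegral0 leb setT); apply: eq_Rintegral => x _.
  by rewrite derive_snd// mul0r mul0r.
rewrite -[LHS]/(\int[leb]_(t in `[0, 1]) flux dx w i t) => <-.
rewrite -lee_fin; apply: le_trans (flux_action_bound mu w i coer c0 lam0 C0 dxr dxC) _.
apply: (@le_trans _ _ ((C * lam * L)%:E + (C / (lam * c) * lam ^+ 2)%:E)%E).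
  apply: leeD2l; rewrite [leRHS]EFinM; apply: lee_wpmul2l; last exact: ltW act.
  by rewrite lee_fin divr_ge0// mulr_ge0// ltW.
rewrite -EFinD lee_fin (_ : _ + _ = K * lam).
  by rewrite /lam mulrCA ler_piMr ?(ltW e0)// ler_pdivrMr// mul1r lerDl.
by rewrite /K; field; rewrite !gt_eqF.
Qed.

(** The primitive of [f] vanishes, and by Lebesgue's differentiation theorem its
    derivative is [f] almost everywhere. *)
Lemma zero_on_intervals (f : R -> R) (K : R) : measurable_fun setT f ->
  (forall x, `|f x| <= K) ->
  (forall a b : R, a < b -> \int[leb]_(x in `]a, b[) f x = 0) ->
  {ae leb, forall x, f x = 0}.
Proof.
move=> mf fK f0.
have fi (a b : R) : leb.-integrable `[a, b] (EFin \o f).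
  apply: measurable_bounded_integrable.
  - exact: measurable_itv.
  - by apply: compact_finite_measure; exact: segment_compact.
  - exact: measurable_funTS.
  - exists K; split; first exact: num_real.
    by move=> B KB x _ /=; apply: le_trans (fK x) (ltW KB).
have lf : locally_integrable setT f.
  split => //; first exact: openT.
  move=> D _ cD.
  have iD : leb.-integrable D (EFin \o f).
    apply: measurable_bounded_integrable.
    - exact: compact_measurable.
    - exact: compact_finite_measure.
    - exact: measurable_funTS.
    - exists K; split; first exact: num_real.
      by move=> B KB x _ /=; apply: le_trans (fK x) (ltW KB).
  by move/integrableP : iD => [].
have := lebesgue_differentiation lf.
apply: (@filterS _ _ (ae_filter_ringOfSetsType _)) => x lx.
have xu : x < x + 1 by rewrite ltrDl.
have [|_ <-] := FTC1_lebesgue_pt xu (fi (x - 1) (x + 1)) _ lx.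
  by rewrite lte_fin ltrBlDr ltrDl.
rewrite derive1E (_ : (fun y => _) = cst 0) ?derive_cst//; apply/funext => y.
have [h|h] := ltP (x - 1) y; last first.
  move: h; rewrite le_eqVlt => /predU1P[->|h]; first by rewrite set_itv1 Rintegral_set1.
  by rewrite set_itv_ge ?Rintegral_set0// bnd_simp -ltNge.
rewrite -[RHS](f0 _ _ h) /Rintegral integral_itv_bndoo//.
by apply/measurable_EFinP; exact: measurable_funTS.
Qed.

(** The smooth cut-offs of an interval converge to its indicator, so the
    difference of the end points has integral 0 over every interval. *)
Lemma zero_distance_eq (m0 m1 : mspace S) :
  {within S, continuous M} ->
  (forall e : R, 0 < e -> exists2 c, curves 1 m0 m1 c &
     (action M c.1 c.2 < e%:E)%E) ->
  m0 = m1.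
Proof.
move=> cM small.
have [K [K0 mK]] := mspace_bounded compactS.
have ae_i i : {ae leb, forall x, m1 x i 0 - m0 x i 0 = 0}.
  apply: (@zero_on_intervals _ (K + K)).
  - by apply: measurable_funB; exact: measurable_mspace.
  - by move=> x; apply: le_trans (ler_normB _ _) _; rewrite lerD.
  move=> a b ab.
  pose D : set R := `]a, b[%classic.
  have mD : measurable D by exact: measurable_itv.
  have iD (g : R -> R) (B : R) : measurable_fun setT g -> (forall x, `|g x| <= B) ->
      leb.-integrable D (EFin \o g).
    move=> mg gB; apply: (@integrableS _ _ _ leb (`[a, b]%classic : set R) D).
    - exact: measurable_itv.
    - exact: mD.
    - exact: subset_itv_oo_cc.
    apply: measurable_bounded_integrable.
    - exact: measurable_itv.
    - by apply: compact_finite_measure; exact: segment_compact.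
    - exact: measurable_funTS.
    - exists B; split; first exact: num_real.
      by move=> B' BB' x _ /=; apply: le_trans (gB x) (ltW BB').
  pose rho k : R -> R := cutoff k.+1%:R a b.
  have rho_out k x : ~ D x -> rho k x = 0.
    move=> nD; apply: cutoff_out; first by rewrite ltr0n.
    move: nD; rewrite /D /= in_itv/= => /negP; rewrite negb_and -!leNgt.
    have h : 0 <= (k.+1%:R : R)^-1 by rewrite invr_ge0 ler0n.
    move=> /orP[h1|h1]; apply/orP; [left|right].
      by apply: le_trans h1 _; rewrite lerDl.
    by apply: le_trans h1; rewrite gerBl.
  have Erho k : \int[leb]_(x in D) (rho k x * (m1 x i 0 - m0 x i 0)) = 0.
    have mrho (m : mspace S) : measurable_fun setT (fun x => rho k x * m x i 0).
      apply: measurable_funM; last exact: measurable_mspace.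
      by apply: continuous_measurable_fun; apply: smooth_on_continuous; exact: smooth_cutoff.
    have brho (m : mspace S) x : `|rho k x * m x i 0| <= K.
      rewrite normrM ger0_norm ?cutoff_ge0//.
      by rewrite (le_trans _ (mK m x i))// ler_piMl// cutoff_le1.
    under eq_Rintegral do rewrite mulrBr.
    rewrite RintegralB//; try by apply: (iD _ K).
    have full (m : mspace S) : \int[leb]_(x in D) (rho k x * m x i 0) =
        \int[leb]_x (rho k x * m x i 0).
      rewrite Rintegral_mkcond; apply: eq_Rintegral => x _.
      rewrite patchE; case: ifPn => // /negP h; rewrite rho_out ?mul0r// => Dx.
      by apply: h; rewrite inE.
    rewrite !full (zero_distance_pairing (r := `|a| + `|b|) i cM small) ?subrr//.
      exact: smooth_cutoff.
    move=> x xr; apply: rho_out; rewrite /D /= in_itv/= => /andP[ax xb].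
    have : `|x| <= `|a| + `|b|.
      rewrite ler_norml opprD; apply/andP; split.
        rewrite -[x]addr0 lerD ?oppr_le0// (le_trans _ (ltW ax))//.
        by rewrite lerNl -normrN ler_norm.
      by apply: le_trans (ltW xb) _; rewrite -[b]add0r lerD// ?add0r// ler_norm.
    by rewrite leNgt xr.
  have cv : \int[leb]_(x in D) (rho k x * (m1 x i 0 - m0 x i 0)) @[k --> \oo] -->
      \int[leb]_(x in D) (m1 x i 0 - m0 x i 0).
    apply: (@Rintegral_dominated_cvg _ _ _ leb D
      (fun k x => rho k x * (m1 x i 0 - m0 x i 0)) _ (cst (K + K))).
    - exact: mD.
    - move=> k; apply: measurable_funTS; apply: measurable_funM.
        by apply: continuous_measurable_fun; apply: smooth_on_continuous; exact: smooth_cutoff.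
      by apply: measurable_funB; exact: measurable_mspace.
    - move=> x Dx; rewrite -[X in _ --> X]mul1r; apply: cvgM; last exact: cvg_cst.
      by have := @cutoff_cvg R a b x; rewrite indicE mem_set.
    - apply: (iD _ (K + K)) => // x.
      by rewrite ger0_norm// addr_ge0.
    - move=> k x _; rewrite normrM ger0_norm ?cutoff_ge0//.
      apply: le_trans (_ : `|m1 x i 0 - m0 x i 0| <= _).
        by rewrite ler_piMl// cutoff_le1.
      by apply: le_trans (ler_normB _ _) _; rewrite lerD.
  rewrite -(cvg_lim (@Rhausdorff R) cv); under eq_fun do rewrite Erho.
  exact: lim_cst.
have ae_eq : {ae leb, forall x, m0 x = m1 x}.
  have := @filter_forall _ _ _ (almost_everywhere leb) (ae_filter_ringOfSetsType leb) ae_i.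
  apply: (@filterS _ _ (ae_filter_ringOfSetsType _)) => x h.
  apply/matrixP => i j; rewrite ord1; apply/eqP.
  by rewrite eq_sym -subr_eq0 h.
rewrite -[m0]reprK -[m1]reprK; apply/eqmodP.
exact/asboolP.
Qed.

End Increment.

(** * The metric axioms *)
Section Metric.
Context {R : realType} (n : nat) (S : set 'cV[R]_n) (M : 'cV[R]_n -> 'M[R]_n).
Hypothesis posM : forall z, interior S z -> sym_posdef (M z).
Hypothesis compactS : compact S.
Implicit Types m : mspace S.

(** The square of the distance. *)
Definition energy (m0 m1 : mspace S) : \bar R :=
  ereal_inf [set action M c.1 c.2 | c in curves 1 m0 m1].

Lemma energy_ge0 m0 m1 : (0 <= energy m0 m1)%E.
Proof. by apply: le_ereal_inf_tmp => _ [c _ <-]; exact: action_ge0. Qed.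

Lemma energy_le m0 m1 mu w : curves 1 m0 m1 (mu, w) ->
  (energy m0 m1 <= action M mu w)%E.
Proof. by move=> h; apply: ereal_inf_lbound; exists (mu, w). Qed.

Lemma energy_sym m0 m1 : energy m0 m1 = energy m1 m0.
Proof.
have le a b : (energy a b <= energy b a)%E.
  apply: le_ereal_inf_tmp => _ [[mu w] cmw <-] /=.
  apply: le_trans (energy_le (curves_reverse compactS cmw)) _.
  exact: action_reverse.
by apply/eqP; rewrite eq_le !le.
Qed.

(** Near-minimizers, for the distance itself rather than for its square. *)
Lemma sqrte_lt_curve m0 m1 (p : R) : 0 < p -> (sqrte (energy m0 m1) < p%:E)%E ->
  exists2 c, curves 1 m0 m1 c & (action M c.1 c.2 < (p ^+ 2)%:E)%E.
Proof.
move=> p0 h.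
have : (energy m0 m1 < (p ^+ 2)%:E)%E.
  rewrite ltNge -lee_sqrt ?energy_ge0// -ltNge.
  by rewrite /sqrte sqrtr_sqr gtr0_norm.
by move=> /ereal_inf_lt[_ [c cc <-] lt]; exists c.
Qed.

(** Curves of action below [p ^ 2] and [q ^ 2] are glued at the time that is
    proportional to their lengths. *)
Lemma W_triangle m0 m1 m2 : (W M m0 m2 <= W M m0 m1 + W M m1 m2)%E.
Proof.
rewrite /W -/(energy m0 m1) -/(energy m1 m2) -/(energy m0 m2).
have := sqrte_ge0 (energy m0 m1); have := sqrte_ge0 (energy m1 m2).
case ab : (sqrte (energy m0 m1)) => [a| |] //; last first.
  by move=> b0 _; rewrite addye ?leey// gt_eqF// (lt_le_trans _ b0)// ltNyr.
case bc : (sqrte (energy m1 m2)) => [b| |] //; last by rewrite addey ?leey.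
rewrite !lee_fin => b0 a0; apply/lee_addgt0Pr => e e0.
pose p := a + e / 2; pose q := b + e / 2.
have e2 : 0 < e / 2 by rewrite divr_gt0.
have p0 : 0 < p by rewrite ltr_wpDl.
have q0 : 0 < q by rewrite ltr_wpDl.
have [||[mu1 w1] c1 lt1] := @sqrte_lt_curve m0 m1 p => //.
  by rewrite ab lte_fin ltrDl.
have [||[mu2 w2] c2 lt2] := @sqrte_lt_curve m1 m2 q => //.
  by rewrite bc lte_fin ltrDl.
(* The minimizer over ]0, 1[ of p ^ 2 / s + q ^ 2 / (1 - s). *)
pose s := p / (p + q).
have pq0 : 0 < p + q by rewrite addr_gt0.
have s1E : 1 - s = q / (p + q) by rewrite /s; field; rewrite gt_eqF.
have s0 : 0 < s by rewrite divr_gt0.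
have s10 : 0 < 1 - s by rewrite s1E divr_gt0.
have s01 : 0 < s < 1 by rewrite s0 -subr_gt0.
have sV0 : 0 <= s^-1 by rewrite invr_ge0 ltW.
have sV1 : 0 <= (1 - s)^-1 by rewrite invr_ge0 ltW.
have : (energy m0 m2 <= ((p + q) ^+ 2)%:E)%E.
  apply: le_trans (energy_le (curves_glue compactS s01 c1 c2)) _.
  apply: le_trans (action_glue posM _ _ _ _ s01) _.
  apply: (@le_trans _ _ ((s^-1)%:E * (p ^+ 2)%:E + ((1 - s)^-1)%:E * (q ^+ 2)%:E)%E).
    by apply: leeD; apply: lee_wpmul2l; rewrite ?lee_fin//; exact: ltW.
  rewrite -!EFinM -EFinD lee_fin s1E /s le_eqVlt; apply/orP; left; apply/eqP.
  by field; rewrite !gt_eqF.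
rewrite -lee_sqrt ?lee_fin ?sqr_ge0// => /le_trans; apply.
rewrite /sqrte sqrtr_sqr gtr0_norm// -!EFinD lee_fin /p /q.
by rewrite addrACA -splitr.
Qed.

Lemma W_eq0 m0 m1 : {within S, continuous M} ->
  (forall z, S z -> closure (interior S) z) ->
  W M m0 m1 = 0%E <-> m0 = m1.
Proof.
move=> cM clS; split => [W0|->].
  apply: (zero_distance_eq posM compactS cM) => e e0.
  have se : 0 < Num.sqrt e by rewrite sqrtr_gt0.
  have [|c cc lt] := @sqrte_lt_curve m0 m1 _ se.
    by rewrite -/(W M m0 m1) W0 lte_fin.
  by exists c => //; rewrite -(sqr_sqrtr (ltW e0)).
rewrite /W -/(energy m1 m1) (_ : energy m1 m1 = 0%E) ?sqrte0//.
apply/eqP; rewrite eq_le energy_ge0 andbT.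
apply: le_trans (energy_le (curves_cst compactS m1)) _.
by rewrite action_cst.
Qed.

End Metric.

Theorem proposition4p11 (R : realType) (n : nat) (S : set 'cV[R]_n)
    (M : 'cV[R]_n -> 'M[R]_n)
    (convexS : convex_set (S : set (convex_lmodType 'cV[R]_n)))
    (compactS : compact S)
    (intS : interior S !=set0)
    (C0_continuous : {within S, continuous M})
    (C0_smooth : smooth_on (interior S) M)
    (C1 : forall z, interior S z -> sym_posdef (M z))
    (C2 : forall z zeta, interior S z -> neg_semidef (second_deriv M z zeta))
    (C3 : forall z nu, bdry S z -> normal_vector S z nu -> M z *m nu = 0) :
  [/\ forall mu0 mu1 : mspace S, (0 <= W M mu0 mu1)%E,
      forall mu0 mu1 : mspace S, W M mu0 mu1 = W M mu1 mu0,
      forall mu0 mu1 mu2 : mspace S,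
        (W M mu0 mu2 <= W M mu0 mu1 + W M mu1 mu2)%E &
      forall mu0 mu1 : mspace S, W M mu0 mu1 = 0%E <-> mu0 = mu1].
Proof.
split => [m0 m1|m0 m1|m0 m1 m2|m0 m1].
- exact: sqrte_ge0.
- by congr sqrte; exact: energy_sym.
- exact: W_triangle.
- by apply: W_eq0 => //; exact: convex_closure_interior.
Qed.
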